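(* Let $\alpha>0$ and $K$ be constants, let $g\ge 0$ be a probability density on $\mathbb{R}$, and for $\epsilon>0$ let $f^{\epsilon}=f^{\epsilon}(\theta,w,\nu,t)\ge 0$ be a solution of $$\epsilon\,\alpha\,(\partial_t f^{\epsilon}+w\,\partial_\theta f^{\epsilon})=Q(f^{\epsilon}),\qquad Q(f):=\partial_w\big((w-\nu-K\Phi_f(\theta,t))\,f\big)+\partial_w^2 f,$$ where $$\Phi_f(\theta,t)=\int_{\mathbb{R}}\int_{\mathbb{R}} f(\theta,w_*,\nu_*,t)\,g(\nu_* )\,\mathrm{d}w_*\,\mathrm{d}\nu_*.$$ Assume that the limit $f^0=\lim_{\epsilon\to 0}f^{\epsilon}$ exists and that the convergence is as regular as necessary (that is, it occurs in function spaces which allow the rigorous justification of all the computations of the limit, such as passing to the limit in the equation and in its moments). The densities $P_\nu$ in the equilibrium form $f^0(\theta,w,\nu,t)=P_\nu(\theta,t)\,M_{V(\theta,\nu,t)}(w)$ of $f^0$ are subject to the standing normalization $\int_{\mathbb{T}}P_\nu(\theta,t)\,\mathrm{d}\theta=1$ and to the standing assumption that $$\int_{\mathbb{R}}\nu_*\,P_{\nu_*}(\theta,t)\,g(\nu_* )\,\mathrm{d}\nu_*=\hat{C}<+\infty,$$ where $\hat{C}$ is a constant. Then $$f^0(\theta,w,\nu,t)=P_\nu(\theta,t)\,M_{V(\theta,\nu,t)}(w),\qquad M_V(w)=\frac{1}{\sqrt{2\pi}}\exp\left(-\tfrac12(w-V)^2\right),$$ where for any $(\theta,t)$ the function $\nu\in\mathbb{R}\mapsto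 P_\nu(\theta,t)\in\mathbb{R}_+$ belongs to $L^1(\mathbb{R})$ and satisfies the normalization condition $\int_{\mathbb{T}}P_\nu(\theta,t)\,\mathrm{d}\theta=1$ and the first-moment condition $\int_{\mathbb{R}}\nu_*\,P_{\nu_*}(\theta,t)\,g(\nu_* )\,\mathrm{d}\nu_*=\hat{C}<+\infty$ with $\hat{C}$ a constant, where $$V=V(\theta,\nu,t)=\nu+K P(\theta,t)=\nu+K\int_{\mathbb{R}}P_{\nu_*}(\theta,t)\,g(\nu_* )\,\mathrm{d}\nu_*$$ belongs to $\mathbb{R}$, and where $\int_{\mathbb{R}}M_V(w)\,\mathrm{d}w=1$. Moreover, the functions $P_\nu(\theta,t)$ and $V(\theta,\nu,t)$ satisfy the system $$\partial_t P_\nu+\partial_\theta(V P_\nu)=0\quad\forall\,\nu\in\mathbb{R},$$ $$P\,\partial_t V+P\,(Y+KP)\,\partial_\theta V+\partial_\theta P=0,$$ with $$P(\theta,t)=\int_{\mathbb{R}}P_{\nu_*}(\theta,t)\,g(\nu_* )\,\mathrm{d}\nu_*,\qquad P(\theta,t)\,Y(\theta,t)=\int_{\mathbb{R}}\nu_*\,P_{\nu_*}(\theta,t)\,g(\nu_* )\,\mathrm{d}\nu_*.$$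
   Context: The variables are the phase $\theta\in\mathbb{T}=[0,2\pi)$ (with $0$ and $2\pi$ identified), the frequency $w\in\mathbb{R}$, the natural frequency $\nu\in\mathbb{R}$ (with $\nu$ in the support of $g$, the probability density of natural frequencies) and time $t\ge 0$. The equation is the nondimensionalized and hydrodynamically rescaled Kuramoto--Sakaguchi--Fokker--Planck equation with inertia and noise (with $\alpha=\sqrt{\sigma m}$, where $m$ is the inertia strength, $\sigma$ the noise strength, and $K$ the coupling strength), in which the interaction force has been replaced by its leading-order local expression $\Phi_f$. The function $f^{\epsilon}$ is a one-oscillator probability density in rescaled variables; it is periodic in $\theta$ and decays to $0$ as $|w|\to\infty$. Existence and uniqueness of solutions, as regular as necessary, is a standing assumption.
   Formalization: The claim that ν ↦ P_ν(θ,t) belongs to L¹(ℝ) is read with respect to the measure g(ν)dν; with plain dν it fails, e.g. for f^ε = f^0 = (1/2π)M_{ν+K/(2π)}(w) with g Gaussian, where P_ν = 1/(2π) for all ν. *)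

(* Defs.v *)
From HB Require Import structures.
From mathcomp Require Import all_boot all_order all_algebra.
From mathcomp Require Import all_classical all_reals all_analysis.

Set Implicit Arguments.
Unset Strict Implicit.
Unset Printing Implicit Defensive.

Import Order.TTheory GRing.Theory Num.Theory.
Import numFieldNormedType.Exports.

Local Open Scope classical_set_scope.
Local Open Scope ring_scope.

(* Phase-space functions take their arguments in the order theta, w, nu, t.
   A function on the torus [0, 2 pi) (endpoints identified) is a
   2 pi-periodic function on R.

   S is the set of natural frequencies on which the unknowns are considered:
   any set containing {g <> 0}. S := setT makes nu range over the whole of R,
   S := closure {g <> 0} makes it range over the support of g. The values of
   the unknowns for nu outside S play no role, since every integral over nu
   carries the weight g. *)

Definition phase_fun (R : realType) := R -> R -> R -> R -> R.

Section derivatives.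
Context {R : realType}.
Implicit Types f : phase_fun R.

Definition Dtheta f : phase_fun R :=
  fun theta w nu t => derive1 (fun x => f x w nu t) theta.

Definition Dw f : phase_fun R :=
  fun theta w nu t => derive1 (fun x => f theta x nu t) w.

Definition Dt f : phase_fun R :=
  fun theta w nu t => derive1 (fun x => f theta w nu x) t.

End derivatives.

Section macroscopic.
Context {R : realType}.
Implicit Types (g : R -> R) (f : phase_fun R) (P : R -> R -> R -> R).
Local Notation mu := (@lebesgue_measure R).

Definition probability_density g :=
  [/\ measurable_fun setT g, forall x, 0 <= g x
    & (\int[mu]_x (g x)%:E = 1)%E].

(* P_nu(theta, t) is written P theta nu t. *)
Definition marginal f : R -> R -> R -> R :=
  fun theta nu t => \int[mu]_w f theta w nu t.

Definition average g P (theta t : R) : R :=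
  \int[mu]_nu (P theta nu t * g nu).

Definition first_moment g P (theta t : R) : R :=
  \int[mu]_nu (nu * P theta nu t * g nu).

Definition Phi g f (theta t : R) : R := average g (marginal f) theta t.

Definition velocity (K : R) g P (theta nu t : R) : R :=
  nu + K * average g P theta t.

(* Y is defined by P Y = first moment. Where P = 0 this quotient is 0, so
   that the relation P Y = first moment has to be stated along with any use
   of Y. *)
Definition Yfun g P (theta t : R) : R :=
  first_moment g P theta t / average g P theta t.

Definition maxwellian (V w : R) : R :=
  (Num.sqrt (2 * pi))^-1 * expR (- (2^-1 * (w - V) ^+ 2)).

Definition Q (K : R) g f : phase_fun R := fun theta w nu t =>
  derive1 (fun x => (x - nu - K * Phi g f theta t) * f theta x nu t) w
  + Dw (Dw f) theta w nu t.

End macroscopic.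

Section regularity.
Context {R : realType}.
Implicit Types (S : set R) (g : R -> R) (f : phase_fun R).
Local Notation mu := (@lebesgue_measure R).

(* Joint continuity in (theta, w, t), for times in I. *)
Definition jointly_continuous S (I : set R) f :=
  forall nu, S nu -> {within [set p : R * R * R | I p.2],
    continuous (fun p : R * R * R => f p.1.1 p.1.2 nu p.2)}.

(* f is continuous up to t = 0; the derivatives entering the equation are
   classical and continuous for t > 0. *)
Definition regular S g f :=
  [/\ forall theta w nu t, S nu -> 0 < t ->
        [/\ derivable (fun x => f x w nu t) theta 1,
            derivable (fun x => f theta x nu t) w 1,
            derivable (fun x => Dw f theta x nu t) w 1
          & derivable (fun x => f theta w nu x) t 1],
      jointly_continuous S [set t | 0 <= t] f,
      [/\ jointly_continuous S [set t | 0 < t] (Dtheta f),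
          jointly_continuous S [set t | 0 < t] (Dw f),
          jointly_continuous S [set t | 0 < t] (Dw (Dw f))
        & jointly_continuous S [set t | 0 < t] (Dt f)]
    & forall t, 0 <= t -> measurable_fun [set: R * R * R]
        (fun p : R * R * R => f p.1.1 p.1.2 p.2 t * g p.2)].

(* The integrability clauses make the integral Phi g f finite. *)
Definition kinetic_density S g f :=
  [/\ forall theta w nu t, S nu -> 0 <= t -> 0 <= f theta w nu t,
      forall theta w nu t, S nu -> 0 <= t ->
        f (theta + 2 * pi) w nu t = f theta w nu t,
      forall theta nu t, S nu -> 0 <= t ->
        (f theta w nu t @[w --> +oo] --> (0 : R)) /\
        (f theta w nu t @[w --> -oo] --> (0 : R)),
      forall theta nu t, S nu -> 0 <= t ->
        mu.-integrable setT (fun w => (f theta w nu t)%:E)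
    & forall theta t, 0 <= t ->
        mu.-integrable setT (fun nu => (marginal f theta nu t * g nu)%:E)].

Definition kinetic_solution (alpha K eps : R) S g f :=
  [/\ regular S g f, kinetic_density S g f
    & forall theta w nu t, S nu -> 0 < t ->
        eps * alpha * (Dt f theta w nu t + w * Dtheta f theta w nu t)
        = Q K g f theta w nu t].

(* Pointwise convergence F e --> F0 as e --> 0+, for times in I, with a bound
   which is uniform in theta, in small e, and in t on compact subintervals of
   I, and which is integrable against the weight 1 + |w|: in w for each nu,
   and in (w, nu) against g(nu). *)
Definition dominated_cvg S g (I : set R) (F : R -> phase_fun R)
    (F0 : phase_fun R) :=
  (forall theta w nu t, S nu -> I t ->
     F e theta w nu t @[e --> 0^'+] --> F0 theta w nu t) /\
  (forall a b : R, `[a, b] `<=` I -> exists H : R -> R -> R,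
     [/\ forall nu, S nu ->
           mu.-integrable setT (fun w => ((1 + `|w|) * H w nu)%:E),
         (mu \x mu)%E.-integrable setT
           (fun p : R * R => ((1 + `|p.1|) * H p.1 p.2 * g p.2)%:E)
       & \forall e \near 0^'+, forall theta w nu t, S nu -> a <= t <= b ->
           `|F e theta w nu t| <= H w nu]).

(* f e --> f0 together with all the derivatives entering the equation; this
   is what allows one to pass to the limit in the equation and in its
   moments. *)
Definition regular_limit S g (f : R -> phase_fun R) (f0 : phase_fun R) :=
  [/\ regular S g f0,
      dominated_cvg S g [set t | 0 <= t] f f0,
      dominated_cvg S g [set t | 0 < t] (fun e => Dtheta (f e)) (Dtheta f0),
      dominated_cvg S g [set t | 0 < t] (fun e => Dt (f e)) (Dt f0)
    & dominated_cvg S g [set t | 0 < t] (fun e => Dw (f e)) (Dw f0) /\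
      dominated_cvg S g [set t | 0 < t]
        (fun e => Dw (Dw (f e))) (Dw (Dw f0))].

End regularity.

Section limit_conditions.
Context {R : realType}.
Implicit Types (S : set R) (g : R -> R) (P : R -> R -> R -> R).
Local Notation mu := (@lebesgue_measure R).

Definition normalized S P := forall nu t, S nu -> 0 <= t ->
  \int[mu]_(theta in `[0, 2 * pi]) P theta nu t = 1.

(* The constant C depends neither on theta nor on t. *)
Definition constant_first_moment g P (C : R) := forall theta t, 0 <= t ->
  mu.-integrable setT (fun nu => (nu * P theta nu t * g nu)%:E) /\
  first_moment g P theta t = C.

(* Integrability in nu is with respect to the measure g(nu) dnu. *)
Definition L1_density S g P :=
  (forall theta nu t, S nu -> 0 <= t -> 0 <= P theta nu t) /\
  (forall theta t, 0 <= t ->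
     mu.-integrable setT (fun nu => (P theta nu t * g nu)%:E)).

Definition equilibrium (K : R) S g (f : phase_fun R) P :=
  forall theta w nu t, S nu -> 0 <= t ->
    f theta w nu t = P theta nu t * maxwellian (velocity K g P theta nu t) w.

Definition continuity_equation (K : R) S g P :=
  forall theta nu t, S nu -> 0 < t ->
    let V := velocity K g P in
    [/\ derivable (fun s => P theta nu s) t 1,
        derivable (fun x => V x nu t * P x nu t) theta 1
      & derive1 (fun s => P theta nu s) t
        + derive1 (fun x => V x nu t * P x nu t) theta = 0].

Definition velocity_equation (K : R) g P :=
  forall theta nu t, 0 < t ->
    let V := velocity K g P in
    let Pbar := average g P in
    let Y := Yfun g P in
    [/\ derivable (fun s => V theta nu s) t 1,
        derivable (fun x => V x nu t) theta 1,
        derivable (fun x => Pbar x t) theta 1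
      & Pbar theta t * derive1 (fun s => V theta nu s) t
        + Pbar theta t * (Y theta t + K * Pbar theta t)
            * derive1 (fun x => V x nu t) theta
        + derive1 (fun x => Pbar x t) theta = 0].

End limit_conditions.

(* Main.v *)
Require Import Defs.
From HB Require Import structures.
From mathcomp Require Import all_boot all_order all_algebra.
From mathcomp Require Import all_classical all_reals all_analysis.
From mathcomp Require Import measurable_realfun.
From mathcomp Require Import ring lra.

Set Implicit Arguments.
Unset Strict Implicit.
Unset Printing Implicit Defensive.

Import Order.TTheory GRing.Theory Num.Theory.
Import numFieldNormedType.Exports.

Local Open Scope classical_set_scope.
Local Open Scope ring_scope.

(** Let [P] be the mass of the limit [f0] in the velocity variable, and let [A]
    be the average of [P] against [g].

    Equilibrium. For positive times the equation at [eps] tends to [Q f0 = 0],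
    so the flux [(w - V) f0 + Dw f0] does not depend on [w]. It is also
    integrable in [w], so it is zero, and this first-order equation forces
    [f0 = P M_V] ([flux_eq0], [maxwellian_profile]). Time 0 is reached by
    continuity ([limit_equilibrium]).

    Continuity equation. For every [eps] the collision term is the derivative of
    an integrable flux, so its mean is zero, and hence so is the mean of
    [Dt f + w Dtheta f]. The bounds with weight [1 + |w|] carry this to the limit
    ([transport_mean]), and the mean velocity of [f0] is [V P] because the flux
    of [f0] vanishes ([Rintegral_velocity]).

    Velocity equation. Averaging the continuity equation against [g], with the
    first moment equal to the constant [C], gives the Burgers equation
    [Dt A + 2 K A Dtheta A = 0] ([average_burgers]). Inserting it in the left-hand
    side of the velocity equation leaves [(1 + K C - K^2 A^2) Dtheta A]. What
    makes this vanish is not a balance of moments but the fact that the limit is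
    a classical solution for all positive times: then [A] does not depend on
    [theta] at all ([average_gradient_eq0]).

    - If [K] is not zero, [A] is a periodic solution of the Burgers equation.
      It is constant along straight lines whose slopes are proportional to its
      values, and two lines with different slopes would meet at a later time
      ([periodic_burgers_cst]).
    - If [K] is zero, [A] is stationary, while each [P nu] is carried rigidly
      with its own speed [nu]. Since the speeds are spread by a density, which
      has no atom at speed 0, the gradient of [A] is an average over long times
      of oscillating gradients, and it is zero
      ([free_transport_average_derive]). *)

(** * Dominated convergence along a continuous parameter *)
Lemma near_right_seq (R : realType) (a : R) (Q : R -> Prop) (u : R^nat) :
  (forall n, a < u n) -> u n @[n --> \oo] --> a ->
  (\forall e \near a^'+, Q e) -> \forall n \near \oo, Q (u n).
Proof.
move=> au ua [r /= r0 rQ].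
move/cvgrPdist_lt : ua => /(_ _ r0); apply: filterS => n aun.
exact: rQ.
Qed.

(** The limits [eps --> 0] and [t --> 0] of this development are both one-sided
    limits of a real parameter, and the bounds hold only close to the end point:
    both facts are reduced to the case of sequences. *)
Lemma dominated_cvg_at_right d (T : measurableType d) (R : realType)
    (mu : {measure set T -> \bar R}) (a : R) (F : R -> T -> R) (F0 h : T -> R) :
  mu.-integrable setT (EFin \o h) ->
  (\forall e \near a^'+, measurable_fun setT (F e) /\
    forall x, `|F e x| <= h x) ->
  (forall x, F e x @[e --> a^'+] --> F0 x) ->
  mu.-integrable setT (EFin \o F0) /\
  \int[mu]_x F e x @[e --> a^'+] --> \int[mu]_x F0 x.
Proof.
move=> ih Fh FF0.
have key (u : R^nat) : (forall n, a < u n) -> u n @[n --> \oo] --> a ->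
    mu.-integrable setT (EFin \o F0) /\
    \int[mu]_x F (u n) x @[n --> \oo] --> \int[mu]_x F0 x.
  move=> au ua.
  have [N _ NF] := near_right_seq au ua Fh.
  have mFN n : measurable_fun [set: T] (fun x => (F (u (n + N)%N) x)%:E).
    by apply/measurable_EFinP; apply: (NF _ _).1; exact: leq_addl.
  have cvF x : (F (u (n + N)%N) x)%:E @[n --> \oo] --> (F0 x)%:E.
    apply: cvg_EFin; first exact: nearW.
    rewrite (@cvg_shiftn N _ (fun n => F (u n) x)).
    move/cvg_at_rightP : (FF0 x); exact.
  have mF0 : measurable_fun [set: T] (fun x => (F0 x)%:E).
    apply: (emeasurable_fun_cvg (fun n => EFin \o F (u (n + N)%N))) => [n|x _].
      exact: mFN.
    exact: cvF.
  have := @dominated_convergence _ _ _ mu setT measurableT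
    (fun n => EFin \o F (u (n + N)%N)) (EFin \o F0) (EFin \o h) mFN mF0.
  case=> //.
  - by apply: aeW => x _; exact: cvF.
  - apply: aeW => x n _ /=; rewrite lee_fin.
    by apply: (NF _ _).2; exact: leq_addl.
  move=> iF0 _ cF; split=> //.
  rewrite -(cvg_shiftn N).
  apply: fine_cvg; rewrite fineK//.
  by rewrite integrable_fin_num.
split.
  have au (n : nat) : a < a + n.+1%:R^-1 by rewrite ltrDl invr_gt0.
  apply: (key _ au _).1.
  rewrite -[X in _ --> X]addr0; apply: cvgD; first exact: cvg_cst.
  exact: cvg_harmonic.
by apply/cvg_at_rightP => u [au ua]; have [] := key u au ua.
Qed.

(** * Integrable functions with integrable derivative *)

(** An integrable function need not tend to 0 at infinity, but it is small
    somewhere in every set of infinite measure. This is enough to discard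
    boundary terms along well-chosen end points. *)
Lemma integrable_exists_small (R : realType) (G : R -> R) (D : set R) (e : R) :
  measurable D -> lebesgue_measure D = +oo%E -> 0 < e ->
  (@lebesgue_measure R).-integrable setT (EFin \o G) ->
  exists2 x, D x & `|G x| < e.
Proof.
move=> mD Doo e0 iG; apply: contrapT => noG.
have eG x : D x -> e <= `|G x|.
  by move=> Dx; rewrite leNgt; apply/negP => Gx; apply: noG; exists x.
have /integrableP[mG] : (@lebesgue_measure R).-integrable D (EFin \o G).
  exact: integrableS iG.
apply/negP; rewrite -leNgt.
have <- : (\int[@lebesgue_measure R]_(x in D) e%:E = +oo)%E.
  by rewrite integral_cst// [X in (_ * X)%E]Doo mulry gtr0_sg// mul1e.
apply: ge0_le_integral => //=.
- by move=> _ _; rewrite lee_fin ltW.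
- by apply/measurable_EFinP; apply: measurableT_comp => //; exact/measurable_EFinP.
Qed.

Lemma integrable_cst_eq0 (R : realType) (c : R) :
  (@lebesgue_measure R).-integrable setT (EFin \o cst c) -> c = 0.
Proof.
move=> ic; apply/eqP; rewrite -normr_le0 leNgt; apply/negP => c0.
have Too : lebesgue_measure [set: R] = +oo%E.
  by rewrite -set_itvE lebesgue_measure_itv.
have [x _] := integrable_exists_small measurableT Too c0 ic.
by rewrite ltxx.
Qed.

Lemma measurable_fun_patch_itv (R : realType) (f : R -> R) (i : interval R) :
  continuous f -> measurable_fun setT (f \_ [set` i]).
Proof.
move=> cf; have mf D : measurable_fun D f.
  by apply: measurable_funTS; exact: continuous_measurable_fun.
exact: (measurable_restrictT f (measurable_itv i)).1 (mf _).
Qed.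

(** On intervals whose end points run to infinity and are chosen where [G] is
    small, the fundamental theorem of calculus gives increments of [G] tending
    to 0. *)
Lemma Rintegral_derive1_eq0 (R : realType) (G G' : R -> R) :
  (forall x : R, is_derive x 1 G (G' x)) -> continuous G' ->
  (@lebesgue_measure R).-integrable setT (EFin \o G) ->
  (@lebesgue_measure R).-integrable setT (EFin \o G') ->
  \int[@lebesgue_measure R]_x G' x = 0.
Proof.
move=> dG cG' iG iG'.
have harm (n : nat) : 0 < n.+1%:R^-1 :> R by rewrite invr_gt0.
have rooM (n : nat) : lebesgue_measure `[n.+1%:R : R, +oo[%classic = +oo%E.
  by rewrite lebesgue_measure_itv/= ?ltry ?ltNyr.
have looM (n : nat) : lebesgue_measure `]-oo, (- n.+1%:R : R)]%classic = +oo%E.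
  by rewrite lebesgue_measure_itv/= ?ltry ?ltNyr.
have A n : {ab : R * R | [/\ n.+1%:R <= ab.2, ab.1 <= - n.+1%:R,
    `|G ab.1| < n.+1%:R^-1 & `|G ab.2| < n.+1%:R^-1]}.
  apply: cid.
  have [b /= + Gb] := integrable_exists_small (measurable_itv _) (rooM n) (harm n) iG.
  have [a /= + Ga] := integrable_exists_small (measurable_itv _) (looM n) (harm n) iG.
  rewrite !in_itv/= andbT => an nb.
  by exists (a, b).
pose a n := (sval (A n)).1; pose b n := (sval (A n)).2.
have abP n : [/\ n.+1%:R <= b n, a n <= - n.+1%:R,
    `|G (a n)| < n.+1%:R^-1 & `|G (b n)| < n.+1%:R^-1].
  by rewrite /a /b; case: (A n).
have FTC n : \int[lebesgue_measure]_(x in `[a n, b n]) G' x = G (b n) - G (a n).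
  have [nb an _ _] := abP n.
  have n0 : 0 < n.+1%:R :> R by rewrite ltr0n.
  rewrite /Rintegral (continuous_FTC2 (F := G))//=.
  - by apply: (le_lt_trans an); apply: (lt_le_trans _ nb); rewrite gtrN.
  - exact: continuous_subspaceT.
  - have cG x : {for x, continuous G}.
      by apply: differentiable_continuous; apply/derivable1_diffP; exact: ex_derive.
    split; first by move=> x _; exact: ex_derive.
    + exact: cvg_at_right_filter (cG _).
    + exact: cvg_at_left_filter (cG _).
  - by move=> x _; rewrite derive1E derive_val.
apply: (@cvg_unique _ (@Rhausdorff R) (G (b n) - G (a n) @[n --> \oo])).
  have -> : (fun n => G (b n) - G (a n)) =
      (fun n => \int[lebesgue_measure]_x ((G' \_ `[a n, b n]) x)).
    by apply/funext => n; rewrite -FTC Rintegral_mkcond.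
  pose F n := EFin \o (G' \_ `[a n, b n]).
  have mF n : measurable_fun setT (F n).
    apply/measurable_EFinP.
    exact: measurable_fun_patch_itv.
  have := @dominated_convergence _ _ _ (@lebesgue_measure R) setT measurableT
    F (EFin \o G') (fun x => `|G' x|%:E) mF (measurable_int _ iG').
  case.
  - apply: aeW => x _; apply: cvg_near_cst.
    near=> n.
    rewrite /F /= patchE mem_set//= in_itv/=.
    have [nb an _ _] := abP n.
    suff : `|x| <= n.+1%:R.
      rewrite ler_norml => /andP[nx xn].
      by rewrite (le_trans an)//= (le_trans xn).
    apply: ltW; rewrite (@lt_le_trans _ _ n%:R) ?ler_nat//.
    by near: n; exact: nbhs_infty_gtr.
  - exact: integrable_norm.
  - apply: aeW => x n _; rewrite /F /= patchE lee_fin.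
    by case: ifP => //; rewrite normr0.
  move=> _ _ cF; apply: fine_cvg; rewrite fineK//.
  by rewrite integrable_fin_num.
apply: norm_cvg0.
apply: (@squeeze_cvgr _ _ _ _ (cst 0) (fun n => n.+1%:R^-1 + n.+1%:R^-1)).
- apply: nearW => n; rewrite /= normr_ge0/=.
  have [_ _ Ga Gb] := abP n.
  by rewrite (le_trans (ler_normB _ _))// lerD// ltW.
- exact: cvg_cst.
- by rewrite -[X in _ --> X]addr0; apply: cvgD; exact: cvg_harmonic.
Unshelve. all: by end_near. Qed.

(** * Derivatives of functions of two variables and of integrals *)
Lemma measurable_fun_cvg_at_right d (T : measurableType d) (R : realType)
    (a : R) (F : R -> T -> R) (F0 : T -> R) :
  (\forall e \near a^'+, measurable_fun setT (F e)) ->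
  (forall x, F e x @[e --> a^'+] --> F0 x) -> measurable_fun setT F0.
Proof.
move=> mF FF0; pose u (n : nat) : R := a + n.+1%:R^-1.
have au n : a < u n by rewrite ltrDl invr_gt0.
have ua : u n @[n --> \oo] --> a.
  by rewrite -[X in _ --> X]addr0; apply: cvgD;
    [exact: cvg_cst|exact: cvg_harmonic].
have [N _ NF] := near_right_seq au ua mF.
apply: (measurable_fun_cvg (h := fun n => F (u (n + N)%N))) => [n|x _].
  exact/NF/leq_addl.
rewrite (@cvg_shiftn N _ (fun n => F (u n) x)).
by move/cvg_at_rightP : (FF0 x); exact.
Qed.

Lemma is_derive1P (R : realType) (f : R -> R) (x df : R) :
  is_derive x 1 f df <-> h^-1 * (f (h + x) - f x) @[h --> 0^'] --> df.
Proof.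
have E : (fun h => h^-1 *: (f (h *: 1 + x) - f x)) =
    (fun h : R => h^-1 * (f (h + x) - f x)).
  by apply/funext => h; rewrite [h *: 1]mulr1.
split=> [[fx <-]|fdf].
  by move: fx; rewrite /derivable /derive E.
have cf : cvg (h^-1 *: (f (h *: 1 + x) - f x) @[h --> (0:R)^']).
  by rewrite E; apply/cvg_ex; exists df.
by apply: DeriveDef => //; rewrite /derive E; exact/cvg_lim.
Qed.

Lemma MVT_between (R : realType) (f df : R -> R) (x y : R) :
  (forall z : R, `|z - x| <= `|y - x| -> is_derive z 1 f (df z)) ->
  exists2 c, `|c - x| <= `|y - x| & f y - f x = df c * (y - x).
Proof.
move=> dfx.
have cf a b : a <= x <= b -> (`|a - x| <= `|y - x|) -> (`|b - x| <= `|y - x|) ->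
    {within `[a, b], continuous f}.
  move=> /andP[ax xb] ay by_; apply: derivable_within_continuous => z.
  rewrite in_itv/= => /andP[az zb].
  suff /dfx : `|z - x| <= `|y - x| by move=> /@ex_derive.
  have [zx|xz] := leP z x.
    rewrite (le_trans _ ay)// !ler0_norm ?subr_le0//.
    by rewrite lerN2 lerD2r.
  rewrite (le_trans _ by_)// !ger0_norm ?subr_ge0 ?(ltW xz)//.
  by rewrite lerD2r.
have [xy|yx] := leP x y.
  have [||c] := @MVT_segment _ f df x y xy.
  - move=> z; rewrite in_itv/= => /andP[xz zy]; apply: dfx.
    by rewrite !ger0_norm ?subr_ge0// ?(ltW xz)// lerD2r ltW.
  - by apply: cf; rewrite ?lexx// subrr normr0.
  rewrite in_itv/= => /andP[xc cy] fxy; exists c => //.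
  by rewrite !ger0_norm ?subr_ge0// lerD2r.
have [||c] := @MVT_segment _ f df y x (ltW yx).
- move=> z; rewrite in_itv/= => /andP[yz zx]; apply: dfx.
  by rewrite !ler0_norm ?subr_le0 ?(ltW zx) ?(ltW yx)// lerN2 lerD2r ltW.
- by apply: cf; rewrite ?lexx ?(ltW yx)// subrr normr0.
rewrite in_itv/= => /andP[yc cx] fxy; exists c.
  by rewrite !ler0_norm ?subr_le0 ?(ltW yx)// lerN2 lerD2r.
by rewrite -[LHS]opprB fxy -mulrN opprB.
Qed.

(** Only one of the two partial derivatives has to be continuous: the increment is
    split into a step in [x] at the displaced time, where the mean value theorem
    applies, and a step in time at the fixed [x]. *)
Lemma is_derive_line (R : realType) (F F1 F2 : R -> R -> R) (a b k s : R) :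
  (forall x t : R, 0 < t -> is_derive x 1 (fun x => F x t) (F1 x t)) ->
  (forall x t : R, 0 < t -> is_derive t 1 (fun t => F x t) (F2 x t)) ->
  (forall x t : R, 0 < t ->
    F1 p.1 p.2 @[p --> (x, t)] --> F1 x t) ->
  0 < b + s ->
  is_derive s 1 (fun s => F (a + k * s) (b + s))
    (k * F1 (a + k * s) (b + s) + F2 (a + k * s) (b + s)).
Proof.
move=> d1 d2 c1; set x := a + k * s; set t := b + s => t0.
apply/is_derive1P.
have -> : (fun h => h^-1 * (F (a + k * (h + s)) (b + (h + s)) - F x t)) =
    (fun h => h^-1 * (F (k * h + x) (h + t) - F x (h + t))
      + h^-1 * (F x (h + t) - F x t)).
  apply/funext => h; rewrite -mulrDr subrKA /x /t.
  by congr (_ * (F _ _ - _)); ring.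
apply: cvgD; last exact/is_derive1P/d2.
apply/cvgrPdist_le => e e0.
have e'0 : 0 < e / (`|k| + 1) by rewrite divr_gt0// ltr_wpDl.
have /cvgrPdist_le/(_ _ e'0) := c1 x t t0.
move=> [[A B] /= [[r1 /= r10 Ar1] [r2 /= r20 Br2]] AB].
have r3 : 0 < Num.min r2 t by rewrite lt_min r20.
have r1k : 0 < r1 / (`|k| + 1) by rewrite divr_gt0// ltr_wpDl.
exists (Num.min (Num.min r2 t) (r1 / (`|k| + 1))) => /=.
  by rewrite lt_min r3.
move=> h /=; rewrite sub0r normrN !lt_min => /andP[/andP[hr2 ht] hr1] h0.
have ht0 : 0 < h + t.
  by move: ht; rewrite ltr_norml => /andP[ht _]; rewrite -ltrBlDr sub0r.
have [|c cx ->] := @MVT_between _ (fun z => F z (h + t)) (fun z => F1 z (h + t)) x (k * h + x).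
  by move=> z _; exact: d1.
rewrite addrK in cx *.
rewrite (mulrC (F1 _ _)) mulrA mulrA (mulrC _ k) -(mulrA k) mulVf// mulr1.
rewrite -mulrBr normrM.
have cr1 : `|x - c| < r1.
  rewrite distrC (le_lt_trans cx)// normrM.
  have k1 : 0 < `|k| + 1 by rewrite ltr_wpDl.
  move: hr1; rewrite ltr_pdivlMr// => /le_lt_trans; apply.
  by rewrite mulrC ler_wpM2l// lerDl.
have ABc : `|F1 x t - F1 c (h + t)| <= e / (`|k| + 1).
  apply: (AB (c, h + t)); split => /=; first exact: Ar1.
  by apply: Br2 => /=; rewrite opprD addrCA subrr addr0 normrN.
apply: (le_trans (ler_wpM2l (normr_ge0 k) ABc)).
rewrite mulrA ler_pdivrMr ?ltr_wpDl// mulrC ler_wpM2l// ?ltW//.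
by rewrite ltrDl.
Qed.

(** The unique solution of a linear equation with zero initial datum is zero:
    the energy [z ^+ 2] damped at twice the maximal growth rate cannot
    increase. *)
Lemma linear_ode_eq0 (R : realType) (z b : R -> R) (L T : R) :
  (forall s : R, 0 <= s <= T -> is_derive s 1 z (b s * z s)) ->
  (forall s : R, 0 <= s <= T -> `|b s| <= L) -> z 0 = 0 ->
  forall s : R, 0 <= s <= T -> z s = 0.
Proof.
move=> dz bL z0 s /andP[s0 sT].
pose y r := z r ^+ 2 * expR (- (2 * L) * r).
have dy r : 0 <= r <= T ->
    is_derive r 1 y (2 * z r ^+ 2 * (b r - L) * expR (- (2 * L) * r)).
  move=> rT; have dzr := dz r rT.
  apply: is_derive_eq; rewrite /GRing.scale/=.
  ring.
have [||c] := @MVT_segment _ y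
  (fun r => 2 * z r ^+ 2 * (b r - L) * expR (- (2 * L) * r)) 0 s s0.
- move=> r; rewrite in_itv/= => /andP[r0 rs]; apply: dy.
  by rewrite ltW//= (le_trans (ltW rs)).
- apply: derivable_within_continuous => r; rewrite in_itv/= => /andP[r0 rs].
  have rT : 0 <= r <= T by rewrite r0 (le_trans rs).
  by have := dy r rT => /@ex_derive.
rewrite in_itv/= => /andP[c0 cs] yE.
have cT : 0 <= c <= T by rewrite c0 (le_trans cs).
have : y s <= 0.
  have -> : y s = y s - y 0 by rewrite /y z0 expr0n/= mul0r subr0.
  have bLc : b c - L <= 0 by rewrite subr_le0 (le_trans (ler_norm _))// bL.
  have zc : 0 <= 2 * z c ^+ 2 by rewrite mulr_ge0 ?sqr_ge0.
  by rewrite yE subr0 mulr_le0_ge0// mulr_le0_ge0 ?expR_ge0// mulr_ge0_le0.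
rewrite /y pmulr_lle0 ?expR_gt0// => zs.
by apply/eqP; rewrite -sqrf_eq0 eq_le zs sqr_ge0.
Qed.

(** The integrability of [F' x] follows from that of the difference quotients, so
    that no measurability of the derivative has to be assumed. *)
Lemma is_derive_under_integral d (T : measurableType d) (R : realType)
    (mu : {measure set T -> \bar R}) (F F' : R -> T -> R) (G : T -> R)
    (u v x : R) :
  u < x < v ->
  (forall s, u < s < v -> mu.-integrable setT (EFin \o F s)) ->
  (forall (s : R) y, u < s < v -> is_derive s 1 (F^~ y) (F' s y)) ->
  (forall s y, u < s < v -> `|F' s y| <= G y) ->
  mu.-integrable setT (EFin \o G) ->
  mu.-integrable setT (EFin \o F' x) /\
  is_derive x 1 (fun s => \int[mu]_y F s y) (\int[mu]_y F' x y).
Proof.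
move=> uxv iF dF F'G iG.
have E s y : u < s < v -> derive1 (F^~ y) s = F' s y.
  by move=> usv; rewrite derive1E; have := dF s y usv => /@derive_val.
have pE y : partial1of2 F x y = F' x y by exact: E.
have xuv : `]u, v[%classic x by rewrite /= in_itv.
split.
- have mF' : measurable_fun setT (F' x).
    apply: (@measurable_fun_cvg_at_right _ _ _ 0
      (fun h y => h^-1 * (F (h + x) y - F x y))).
    + case/andP: (uxv) => ux xv; near=> h.
      have h0 : 0 < h by near: h; exact: nbhs_right_gt.
      have hx : u < h + x < v.
        rewrite (lt_le_trans ux) ?lerDr ?(ltW h0)//=.
        by rewrite -ltrBrDr; near: h; apply: nbhs_right_lt; rewrite subr_gt0.
      apply: measurable_funM => //; apply: measurable_funB.
        by have /integrableP[/measurable_EFinP] := iF _ hx.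
      by have /integrableP[/measurable_EFinP] := iF _ uxv.
    + move=> y; apply: cvg_dnbhs_at_right.
      by have /is_derive1P := dF x y uxv.
  apply: le_integrable iG => //; first exact/measurable_EFinP.
  move=> y _ /=; rewrite lee_fin (le_trans (F'G x y uxv))//.
  exact: ler_norm.
have G0 y : 0 <= G y by rewrite (le_trans _ (F'G x y uxv)).
have iF' s : `]u, v[%classic s -> mu.-integrable setT (EFin \o F s).
  by rewrite /= in_itv/=; exact: iF.
have dF' s y : `]u, v[%classic s -> setT y -> derivable (F ^~ y) s 1.
  by rewrite /= in_itv/= => suv _; have := dF s y suv => /@ex_derive.
have bF' s y : `]u, v[%classic s -> setT y -> `|partial1of2 F s y| <= G y.
  by rewrite /= in_itv/= => suv _; rewrite /partial1of2 E// F'G.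
apply: DeriveDef.
  exact: (derivable_under_integral measurableT xuv iF' dF' G0 iG bF').
rewrite -derive1E.
rewrite (differentiation_under_integral measurableT xuv iF' dF' G0 iG bF').
by apply: eq_Rintegral => y _; rewrite pE.
Unshelve. all: by end_near. Qed.

(** * Classical solutions of the Burgers equation *)

(** In a classical solution of the Burgers equation the datum is carried along
    the straight line whose slope is [k] times its own value: the deviation from the initial
    value solves a linear equation along that line. The equation is expressed
    through the derivatives along all lines, with the time derivative already
    replaced by [- k * u * ux]. *)
Lemma burgers_straight_line (R : realType) (u ux : R -> R -> R) (k a t s : R) :
  (forall a l b s : R, 0 < b + s ->
    is_derive s 1 (fun s => u (a + l * s) (b + s))
      ((l - k * u (a + l * s) (b + s)) * ux (a + l * s) (b + s))) ->
  (forall a b : R, 0 < a ->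
    exists L, forall x t, a <= t <= b -> `|ux x t| <= L) ->
  0 < t -> 0 <= s -> u (a + k * u a t * s) (t + s) = u a t.
Proof.
move=> du ubd t0 s0; have [L uL] := ubd t (t + s) t0.
set l := k * u a t.
have pos r : 0 <= r <= s -> 0 < t + r by move=> /andP[r0 _]; rewrite ltr_wpDr.
apply/subr0_eq.
apply: (@linear_ode_eq0 R (fun r => u (a + l * r) (t + r) - u a t)
  (fun r => - k * ux (a + l * r) (t + r)) (`|k| * L) s).
- move=> r rs; have := du a l t r (pos r rs) => dur.
  apply: is_derive_eq; rewrite subr0 /l; ring.
- move=> r /andP[r0 rs]; rewrite normrM normrN ler_wpM2l// uL//.
  by rewrite lerDl r0 lerD2l.
- by rewrite mulr0 !addr0 subrr.
- by rewrite s0/=.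
Qed.

(** Two distinct values would be carried along two straight lines which, up to
    shifting one of them by a multiple of the period, meet at a later time. *)
Lemma periodic_burgers_cst (R : realType) (u ux : R -> R -> R) (k p : R) :
  k != 0 -> 0 < p ->
  (forall a l b s : R, 0 < b + s ->
    is_derive s 1 (fun s => u (a + l * s) (b + s))
      ((l - k * u (a + l * s) (b + s)) * ux (a + l * s) (b + s))) ->
  (forall a b : R, 0 < a ->
    exists L, forall x t, a <= t <= b -> `|ux x t| <= L) ->
  (forall x t, 0 < t -> u (x + p) t = u x t) ->
  forall x y t, 0 < t -> u x t = u y t.
Proof.
move=> k0 p0 du ubd up x y t t0.
have upn n z : u (z + p *+ n) t = u z t.
  by elim: n => [|n IH]; rewrite ?mulr0n ?addr0// mulrSr addrA up.
suff slower a b : ~ k * u b t < k * u a t.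
  apply/eqP; rewrite -(inj_eq (mulfI k0)) eq_le !leNgt.
  by apply/andP; split; apply/negP; exact: slower.
move=> ba.
(* The faster line has to start behind the slower one. *)
pose n := Num.bound `|(a - b) / p|.
have anb : a < b + p *+ n.
  rewrite -ltrBlDl -mulr_natr -ltr_pdivrMl// mulrC.
  exact: le_lt_trans (ler_norm _) (archi_boundP (normr_ge0 _)).
have dl : 0 < k * u a t - k * u b t by rewrite subr_gt0.
pose s := (b + p *+ n - a) / (k * u a t - k * u b t).
have s0 : 0 <= s by rewrite ltW// divr_gt0// subr_gt0.
have ua := burgers_straight_line a du ubd t0 s0.
have ub := burgers_straight_line (b + p *+ n) du ubd t0 s0.
rewrite upn in ub.
have meet : a + k * u a t * s = b + p *+ n + k * u b t * s.
  apply/eqP; rewrite -subr_eq0.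
  have -> : a + k * u a t * s - (b + p *+ n + k * u b t * s) =
    s * (k * u a t - k * u b t) - (b + p *+ n - a) by ring.
  by rewrite /s divfK ?subrr// gt_eqF.
by move: ba; rewrite -ua meet ub ltxx.
Qed.

(** Where the weight vanishes nothing is known about [p]: this is the situation
    of the natural frequencies outside the support of [g]. *)
Lemma is_derive_weight (R : realType) (p : R -> R) (x dp c : R) :
  (c != 0 -> is_derive x 1 p dp) ->
  is_derive x 1 (fun s => p s * c) (dp * c).
Proof.
have [->|c0] := eqVneq c 0; last first.
  by move=> /(_ isT) dpx; apply: is_derive_eq; rewrite /GRing.scale/=; ring.
move=> _; rewrite mulr0.
have -> : (fun s => p s * 0) = cst 0 by apply/funext => s; rewrite mulr0.
exact: is_derive_cst.
Qed.

Lemma is_derive_unique (R : realType) (f : R -> R) (x a b : R) :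
  is_derive x 1 f a -> is_derive x 1 f b -> a = b.
Proof. by move=> /@derive_val <- /@derive_val <-. Qed.

Lemma is_derive_affine (R : realType) (c k : R) (p : R -> R) (x dp : R) :
  is_derive x 1 p dp -> is_derive x 1 (fun s => c + k * p s) (k * dp).
Proof.
by move=> dpx; apply: is_derive_eq; rewrite /GRing.scale/=; ring.
Qed.

(** * Free transport with spread speeds *)
Lemma integrable_mul_bounded d (T : measurableType d) (R : realType)
    (mu : {measure set T -> \bar R}) (q f : T -> R) (M : R) :
  measurable_fun setT q -> (forall x, `|q x| <= M) ->
  mu.-integrable setT (EFin \o f) ->
  mu.-integrable setT (fun x => (q x * f x)%:E).
Proof.
move=> mq qM intf.
have mf : measurable_fun setT f by have /integrableP[/measurable_EFinP] := intf.
have iMf : mu.-integrable setT (fun x => (M%:E * (f x)%:E)%E).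
  exact: integrableZl.
apply: le_integrable iMf => //.
  by apply/measurable_EFinP; exact: measurable_funM.
move=> x _ /=; rewrite lee_fin !normrM ler_wpM2r//.
exact: le_trans (qM x) (ler_norm _).
Qed.

Section free_transport.
Context {R : realType}.
Local Notation mu := (@lebesgue_measure R).

(** The first quotient is a regularized inverse of [nu]; its product with [nu] is
    1 minus the second quotient. *)
Lemma cutoff_bounds (d nu : R) : 0 < d ->
  `|nu / (nu ^+ 2 + d ^+ 2)| <= d^-1 /\
  0 <= d ^+ 2 / (nu ^+ 2 + d ^+ 2) <= 1.
Proof.
move=> d0; have den : 0 < nu ^+ 2 + d ^+ 2.
  by rewrite ltr_wpDl ?sqr_ge0 ?exprn_gt0.
split.
  rewrite normrM normfV (gtr0_norm den) ler_pdivrMr// ler_pdivlMl//.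
  rewrite -(real_normK (num_real nu)).
  have := sqr_ge0 (`|nu| - d); rewrite sqrrB => H.
  have := mulr_ge0 (normr_ge0 nu) (ltW d0); lra.
rewrite divr_ge0 ?sqr_ge0 ?(ltW den)//=.
by rewrite ler_pdivrMr// mul1r lerDr sqr_ge0.
Qed.

(** The only frequency which survives the cutoff is zero, a null set. *)
Lemma cvg_Rintegral_cutoff (k : R -> R) :
  mu.-integrable setT (EFin \o k) ->
  \int[mu]_nu (d ^+ 2 / (nu ^+ 2 + d ^+ 2) * k nu) @[d --> 0^'+] --> (0 : R).
Proof.
move=> ik.
have I0 : \int[mu]_nu ((k \_ [set 0]) nu) = 0.
  by rewrite -Rintegral_mkcond Rintegral_set1.
have [|||_] := @dominated_cvg_at_right _ _ R mu 0
  (fun d nu => d ^+ 2 / (nu ^+ 2 + d ^+ 2) * k nu) (k \_ [set 0])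
  (fun nu => `|k nu|).
- exact: integrable_norm.
- near=> d; have d0 : 0 < d by near: d; exact: nbhs_right_gt.
  split=> [|nu].
    apply: measurable_funM; last first.
      by have /integrableP[/measurable_EFinP] := ik.
    apply: continuous_measurable_fun => nu.
    apply: cvgM; first exact: cvg_cst.
    apply: cvgV.
      by rewrite gt_eqF// ltr_wpDl ?sqr_ge0 ?exprn_gt0.
    apply: cvgD; last exact: cvg_cst.
    exact: exprn_continuous.
  have [_ /andP[c0 c1]] := cutoff_bounds nu d0.
  by rewrite normrM ger0_norm// ler_piMl.
- move=> nu; rewrite patchE; case: ifPn => [/set_mem/= ->|].
    apply: cvg_near_cst; near=> d.
    have d0 : 0 < d by near: d; exact: nbhs_right_gt.
    by rewrite expr0n/= add0r divff ?mul1r// gt_eqF// exprn_gt0.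
  rewrite notin_setE/= => /eqP nu0.
  rewrite -[X in _ --> X](mul0r (k nu)); apply: cvgMr_tmp.
  rewrite -[X in _ --> X](mul0r (nu ^+ 2)^-1).
  apply: cvg_at_right_filter.
  have d2 : d ^+ 2 @[d --> (0 : R)] --> (0 : R).
    by have := @exprn_continuous R 2 0; rewrite /continuous_at expr0n.
  apply: cvgM => //; apply: cvgV; first by rewrite sqrf_eq0.
  rewrite -[X in _ --> X]addr0; apply: cvgD => //; exact: cvg_cst.
- by rewrite I0.
Unshelve. all: by end_near. Qed.

Variables (g k : R -> R) (P Px : R -> R -> R -> R) (t0 : R).
Hypothesis t0_gt0 : 0 < t0.
Hypothesis g_ge0 : forall nu, 0 <= g nu.
Hypothesis P_ge0 : forall x nu t, g nu != 0 -> 0 < t -> 0 <= P x nu t.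
Hypothesis P_int : forall x t, 0 < t ->
  mu.-integrable setT (fun nu => (P x nu t * g nu)%:E).
Hypothesis P_transport : forall a l b s nu : R, g nu != 0 -> 0 < b + s ->
  is_derive s 1 (fun s => P (a + l * s) nu (b + s))
    ((l - nu) * Px (a + l * s) nu (b + s)).
Hypothesis P_derive : forall x nu t : R, g nu != 0 -> 0 < t ->
  is_derive x 1 (fun x => P x nu t) (Px x nu t).
Hypothesis Px_bound : forall x nu, `|Px x nu t0 * g nu| <= k nu.
Hypothesis k_int : mu.-integrable setT (EFin \o k).
Hypothesis Px_int : forall x t, 0 < t ->
  mu.-integrable setT (fun nu => (Px x nu t * g nu)%:E).
Hypothesis average_derive : forall x t : R, 0 < t ->
  is_derive x 1 (fun x => average g P x t) (average g Px x t).
Hypothesis average_stationary : forall x s t, 0 < s -> 0 < t ->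
  average g P x s = average g P x t.

Lemma free_transport_shift x nu s : g nu != 0 -> 0 <= s ->
  P x nu (t0 + s) = P (x - nu * s) nu t0.
Proof.
move=> gnu s0.
pose z r := P (x - nu * s + nu * r) nu (t0 + r).
suff /subr0_eq : z s - z 0 = 0 by rewrite /z mulr0 !addr0 subrK.
apply: (@linear_ode_eq0 R (fun r => z r - z 0) (cst 0) 0 s).
- move=> r /andP[r0 rs].
  have := P_transport (x - nu * s) nu gnu (ltr_wpDr r0 t0_gt0).
  rewrite -/(z r) => dz.
  by apply: is_derive_eq; rewrite subrr mul0r subr0 mul0r.
- by move=> r _; rewrite normr0.
- by rewrite subrr.
- by rewrite s0/=.
Qed.

(** Along the free flow the gradient is only translated, so a bound at time [t0]
    which is uniform in [x] holds at all later times. *)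
Lemma free_transport_bound x nu s : 0 <= s ->
  `|Px x nu (t0 + s) * g nu| <= k nu.
Proof.
move=> s0; have [g0|gnu] := eqVneq (g nu) 0.
  by have := Px_bound x nu; rewrite g0 !mulr0.
suff -> : Px x nu (t0 + s) = Px (x - nu * s) nu t0 by [].
apply: (@is_derive_unique R (fun x => P x nu (t0 + s)) x).
  by apply: P_derive => //; rewrite ltr_wpDr.
have -> : (fun x => P x nu (t0 + s)) = (fun x => P (x - nu * s) nu t0).
  by apply/funext => y; exact: free_transport_shift.
apply/is_derive1P.
have /is_derive1P := P_derive (x - nu * s) gnu t0_gt0.
by under eq_fun do rewrite addrA.
Qed.

(** Dividing by the frequency turns the time derivative of [P] into its space
    derivative. A regularized division gives a functional whose values are
    bounded in time, whereas its slope is arbitrarily close to a constant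
    multiple of the gradient of the average, uniformly in time. *)
Lemma free_transport_average_derive x : average g Px x t0 = 0.
Proof.
set c := average g Px x t0.
have cE s : 0 <= s -> average g Px x (t0 + s) = c.
  move=> s0; have ts : 0 < t0 + s by rewrite ltr_wpDr.
  apply: (is_derive_unique (average_derive x ts)).
  have -> : (fun x => average g P x (t0 + s)) = (fun x => average g P x t0).
    by apply/funext => y; exact: average_stationary.
  exact: average_derive.
suff cr d : 0 < d ->
    `|c| <= \int[mu]_nu (d ^+ 2 / (nu ^+ 2 + d ^+ 2) * k nu).
  apply/eqP; rewrite -normr_le0.
  apply: (cvgr_to_ge (cvg_Rintegral_cutoff k_int)).
  by near=> d; apply: cr; near: d; exact: nbhs_right_gt.
move=> d0; set r := \int[mu]_nu _.
pose q nu := d ^+ 2 / (nu ^+ 2 + d ^+ 2).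
pose h nu := nu / (nu ^+ 2 + d ^+ 2).
have qP nu : 0 <= q nu <= 1 by have [] := cutoff_bounds nu d0.
have hP nu : `|h nu| <= d^-1 by have [] := cutoff_bounds nu d0.
have hq nu : h nu * nu = 1 - q nu.
  have den : nu ^+ 2 + d ^+ 2 != 0.
    by rewrite gt_eqF// ltr_wpDl ?sqr_ge0 ?exprn_gt0.
  by rewrite /h /q; field.
have [mh mq] : measurable_fun setT h /\ measurable_fun setT q.
  have den : continuous (fun nu : R => (nu ^+ 2 + d ^+ 2)^-1).
    move=> nu; apply: cvgV.
      by rewrite gt_eqF// ltr_wpDl ?sqr_ge0 ?exprn_gt0.
    by apply: cvgD; [exact: exprn_continuous|exact: cvg_cst].
  split; apply: continuous_measurable_fun => nu.
    by apply: cvgM; [exact: cvg_id|exact: den].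
  by apply: cvgM; [exact: cvg_cst|exact: den].
have q1 nu : `|q nu| <= 1 by have /andP[q0 ?] := qP nu; rewrite ger0_norm.
have iPg s : 0 <= s -> mu.-integrable setT (fun nu => (P x nu (t0 + s) * g nu)%:E).
  by move=> s0; apply: P_int; rewrite ltr_wpDr.
have iPxg s : 0 <= s -> mu.-integrable setT (fun nu => (Px x nu (t0 + s) * g nu)%:E).
  by move=> s0; apply: Px_int; rewrite ltr_wpDr.
have iqk : mu.-integrable setT (fun nu => (q nu * k nu)%:E).
  exact: (@integrable_mul_bounded _ _ R mu q k 1).
have iqPx s : 0 <= s ->
    mu.-integrable setT (fun nu => (q nu * (Px x nu (t0 + s) * g nu))%:E).
  move=> s0.
  exact: (@integrable_mul_bounded _ _ R mu q _ 1 mq q1 (iPxg s s0)).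
pose B s := \int[mu]_nu (h nu * P x nu (t0 + s) * g nu).
pose B' s := \int[mu]_nu (h nu * (- nu * Px x nu (t0 + s)) * g nu).
have ihP s : 0 <= s ->
    mu.-integrable setT (fun nu => (h nu * P x nu (t0 + s) * g nu)%:E).
  move=> s0; under eq_fun do rewrite -mulrA.
  exact: (@integrable_mul_bounded _ _ R mu h _ _ mh hP (iPg s s0)).
have dB (s : R) : 0 < s -> is_derive s 1 B (B' s).
  move=> s0; have s01 : 0 < s < s + 1 by rewrite s0 ltrDl ltr01.
  have [] // := @is_derive_under_integral _ _ R mu
    (fun s nu => h nu * P x nu (t0 + s) * g nu)
    (fun s nu => h nu * (- nu * Px x nu (t0 + s)) * g nu) k 0 (s + 1) s s01.
  - by move=> v /andP[v0 _]; exact/ihP/ltW.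
  - move=> v nu /andP[v0 _]; apply: is_derive_weight => gnu.
    have := P_transport x 0 gnu (addr_gt0 t0_gt0 v0).
    rewrite mul0r addr0 sub0r.
    under [X in is_derive _ _ X _]eq_fun do rewrite mul0r addr0.
    by move=> dP; apply: is_derive_eq; rewrite /GRing.scale/=; ring.
  - move=> v nu /andP[v0 _].
    have -> : h nu * (- nu * Px x nu (t0 + v)) * g nu =
        - (1 - q nu) * (Px x nu (t0 + v) * g nu) by rewrite -hq; ring.
    have /andP[q0 q1'] := qP nu.
    rewrite normrM normrN (@ger0_norm _ (1 - q nu)) ?subr_ge0//.
    apply: le_trans (free_transport_bound x nu (ltW v0)).
    by rewrite ler_piMl// gerBl.
have E0 s nu : h nu * (- nu * Px x nu (t0 + s)) * g nu =
    q nu * (Px x nu (t0 + s) * g nu) - Px x nu (t0 + s) * g nu.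
  transitivity (- (h nu * nu) * (Px x nu (t0 + s) * g nu)); first by ring.
  by rewrite hq; ring.
have B'c s : 0 < s -> `|B' s + c| <= r.
  move=> /ltW s0.
  have -> : B' s + c = \int[mu]_nu (q nu * (Px x nu (t0 + s) * g nu)).
    rewrite -(cE s s0) /B' /average.
    under eq_Rintegral do rewrite E0.
    by rewrite RintegralB ?subrK//; [exact: iqPx|exact: iPxg].
  rewrite (le_trans (le_normr_Rintegral _ _))//; first exact: iqPx.
  apply: le_Rintegral => //; first exact: (integrable_norm (iqPx s s0)).
  move=> nu _; have /andP[q0 _] := qP nu.
  by rewrite normrM (ger0_norm q0) ler_wpM2l// free_transport_bound.
pose M := d^-1 * average g P x t0.
have BM s : 0 <= s -> `|B s| <= M.
  move=> s0; rewrite (le_trans (le_normr_Rintegral _ _))//; first exact: ihP.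
  have st : 0 < t0 + s by rewrite ltr_wpDr.
  rewrite /M (average_stationary x t0_gt0 st) /average -RintegralZl//;
    last exact: iPg.
  apply: le_Rintegral => //.
  - exact: (integrable_norm (ihP s s0)).
  - by have := integrableZl measurableT d^-1 (iPg s s0).
  move=> nu _; have [g0|gnu] := eqVneq (g nu) 0.
    by rewrite g0 !mulr0 normr0.
  have Pg : 0 <= P x nu (t0 + s) * g nu by rewrite mulr_ge0// P_ge0.
  by rewrite -mulrA normrM (ger0_norm Pg) ler_wpM2r.
(* If |c| exceeded r, the slope of B would stay away from 0, whereas B is
   bounded by M: T is a time after which the increment exceeds 2 M. *)
rewrite leNgt; apply/negP => rc.
have cr0 : 0 < `|c| - r by rewrite subr_gt0.
have M0 : 0 <= M by rewrite (le_trans _ (BM 0 (lexx _))).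
pose T := (2 * M + 1) / (`|c| - r).
have T0 : 0 <= T by rewrite divr_ge0 ?(ltW cr0)// addr_ge0// mulr_ge0.
have le1T : 1 <= 1 + T by rewrite lerDl.
have dB1 s : s \in `]1, 1 + T[ -> is_derive s 1 B (B' s).
  by rewrite in_itv/= => /andP[s1 _]; apply: dB; exact: lt_trans s1.
have cB : {within `[1, 1 + T], continuous B}.
  apply: derivable_within_continuous => s; rewrite in_itv/= => /andP[s1 _].
  by have := dB s (lt_le_trans ltr01 s1) => /@ex_derive.
have [s] := MVT_segment le1T dB1 cB.
rewrite in_itv/= => /andP[s1 _] BE.
have s0 : 0 < s by exact: lt_le_trans ltr01 s1.
have : (`|c| - r) * T <= 2 * M.
  rewrite -(ger0_norm T0).
  apply: (@le_trans _ _ (`|B' s * T|)).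
    rewrite (normrM (B' s)) ler_wpM2r// lerBlDr.
    rewrite (le_trans _ (lerD (lexx _) (B'c s s0)))//.
    by rewrite -[X in `|X| <= _](addKr (B' s)) (le_trans (ler_normD _ _))// normrN.
  have -> : B' s * T = B (1 + T) - B 1 by rewrite BE addrAC subrr add0r.
  rewrite (le_trans (ler_normB _ _))// mulr_natl mulr2n lerD// BM//.
  by rewrite addr_ge0.
by rewrite /T mulrC divfK ?gt_eqF// gerDl ler10.
Unshelve. all: by end_near. Qed.

End free_transport.

(** * The collision term in the velocity variable *)
Lemma maxwellianE (R : realType) (V w : R) :
  maxwellian V w = normal_pdf V 1 w.
Proof.
rewrite normal_pdfE ?oner_eq0// /maxwellian /normal_peak /normal_fun.
rewrite expr1n mul1r mulr_natl; congr (_ * expR _).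
by rewrite mulNr mulrC.
Qed.

Lemma integral_maxwellian (R : realType) (V : R) :
  (\int[@lebesgue_measure R]_w (maxwellian V w)%:E = 1)%E.
Proof.
rewrite -[RHS](@integral_normal_pdf R V 1) ?oner_eq0//.
by apply: eq_integral => w _; rewrite maxwellianE.
Qed.

Section velocity_profile.
Context {R : realType}.
Local Notation mu := (@lebesgue_measure R).
Variables (phi phi1 phi2 psi : R -> R) (V : R).
Hypothesis dphi : forall w : R, is_derive w 1 phi (phi1 w).
Hypothesis dphi1 : forall w : R, is_derive w 1 phi1 (phi2 w).
Hypothesis phi_int : mu.-integrable setT (EFin \o phi).
Hypothesis wphi_int : mu.-integrable setT (fun w => (w * phi w)%:E).
Hypothesis phi1_int : mu.-integrable setT (EFin \o phi1).

Let flux w := (w - V) * phi w + phi1 w.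

Lemma is_derive_flux (w : R) :
  is_derive w 1 flux (phi w + (w - V) * phi1 w + phi2 w).
Proof.
have := dphi w; have := dphi1 w => d1 d2.
by apply: is_derive_eq; rewrite /GRing.scale/=; ring.
Qed.

Lemma integrable_centered : mu.-integrable setT (fun w => ((w - V) * phi w)%:E).
Proof.
have := integrableB measurableT wphi_int (integrableZl measurableT V phi_int).
by under eq_fun do rewrite -EFinM -EFinB -mulrBl.
Qed.

Lemma integrable_flux : mu.-integrable setT (EFin \o flux).
Proof. exact: (integrableD measurableT integrable_centered phi1_int). Qed.

(** The flux and its derivative, the collision term, are both integrable. *)
Lemma Rintegral_collision_eq0 :
  (forall w, phi w + (w - V) * phi1 w + phi2 w = psi w) ->
  continuous psi -> mu.-integrable setT (EFin \o psi) ->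
  \int[mu]_w psi w = 0.
Proof.
move=> psiE cpsi ipsi; apply: (@Rintegral_derive1_eq0 R flux) => //.
  by move=> w; rewrite -psiE; exact: is_derive_flux.
exact: integrable_flux.
Qed.

Hypothesis collisionless : forall w, phi w + (w - V) * phi1 w + phi2 w = 0.

(** A constant flux vanishes because it is integrable. *)
Lemma flux_eq0 w : (w - V) * phi w + phi1 w = 0.
Proof.
have fcst x : flux x = flux 0.
  apply: is_derive_0_is_cst => y; rewrite -(collisionless y).
  exact: is_derive_flux.
rewrite -/(flux w) fcst; apply: integrable_cst_eq0.
by have := integrable_flux; rewrite (_ : flux = cst (flux 0))//; apply/funext.
Qed.

(** The flux [(w - V) * phi w + phi1 w] vanishes and its second term has zero
    mean. *)
Lemma Rintegral_velocity : \int[mu]_w (w * phi w) = V * \int[mu]_w phi w.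
Proof.
have phi1E : phi1 = (fun w => V * phi w - w * phi w).
  by apply/funext => w; have := flux_eq0 w; lra.
have : \int[mu]_w phi1 w = 0.
  apply: (@Rintegral_derive1_eq0 R phi) => // w.
  by have /@ex_derive/derivable1_diffP/differentiable_continuous := dphi1 w.
rewrite phi1E RintegralB//; last exact: (integrableZl measurableT V phi_int).
by rewrite RintegralZl// => /subr0_eq.
Qed.

(** Since the flux vanishes, the product of [phi] with the inverse of the Gaussian
    is constant. *)
Lemma maxwellian_profile w : phi w = (\int[mu]_w phi w) * maxwellian V w.
Proof.
pose E w := phi w * expR (2^-1 * (w - V) ^+ 2).
have Ecst x : E x = E 0.
  apply: is_derive_0_is_cst => y.
  have := dphi y => dy.
  apply: is_derive_eq; rewrite /GRing.scale/=.
  rewrite (_ : phi1 y = - ((y - V) * phi y)); last by have := flux_eq0 y; lra.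
  by field.
set c := Num.sqrt (2 * pi) * E 0.
have c0 : Num.sqrt (2 * pi) != 0 :> R.
  by rewrite gt_eqF// sqrtr_gt0 mulr_gt0// pi_gt0.
have phiE x : phi x = c * maxwellian V x.
  rewrite /c -(Ecst x) /E /maxwellian expRN.
  by field; rewrite c0 gt_eqF ?expR_gt0.
suff -> : \int[mu]_w phi w = c by [].
have -> : phi = (fun x => c * maxwellian V x) by apply/funext.
rewrite RintegralZl//; first by rewrite /Rintegral integral_maxwellian mulr1.
have -> : maxwellian V = normal_pdf V 1 by apply/funext => x; exact: maxwellianE.
exact: integrable_normal_pdf.
Qed.

End velocity_profile.

(** * Majorants of phase-space functions *)

Section majorants.
Context {R : realType}.
Local Notation mu := (@lebesgue_measure R).
Implicit Types (S I : set R) (g : R -> R) (f F : phase_fun R) (h : R -> R -> R).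

(** What dominated convergence needs, first in [w] at a fixed frequency and then
    for the average against [g]. *)
Definition dominating S g h :=
  (forall nu, S nu -> mu.-integrable setT (fun w => (h w nu)%:E)) /\
  mu.-integrable setT (fun nu => ((\int[mu]_w h w nu) * g nu)%:E).

(** The weight makes [h] a majorant of both [F] and [w * F], that is of the
    densities of mass and of momentum. *)
Definition dominated_by S (a b : R) F h := forall theta w nu t,
  S nu -> a <= t <= b -> (1 + `|w|) * `|F theta w nu t| <= h w nu.

(** Fubini's theorem only gives integrable sections almost everywhere; here they
    are integrable for all [y], so that the real-valued partial integral
    coincides with the extended one. *)
Lemma integrable_partial_integral (f : R * R -> R) (D : set R) :
  (mu \x mu)%E.-integrable setT (EFin \o f) ->
  (forall y, D y -> mu.-integrable setT (fun x => (f (x, y))%:E)) ->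
  (forall y, ~ D y -> forall x, f (x, y) = 0) ->
  mu.-integrable setT (fun y => (\int[mu]_x f (x, y))%:E).
Proof.
move=> intf fD f0.
have mf := measurable_int _ intf.
have E : (fun y => (\int[mu]_x f (x, y))%:E) =
    (fun y => \int[mu]_x (f (x, y))%:E)%E.
  apply/funext => y; rewrite /Rintegral fineK//.
  have [Dy|nDy] := pselect (D y).
    by rewrite integrable_fin_num//; exact: fD.
  by under eq_integral do rewrite f0//; rewrite integral0.
rewrite E; apply/integrableP; split.
  exact: (measurable_fubini_G intf).
have := (integrable21ltyP mu mu mf).1 intf.
apply: le_lt_trans; apply: ge0_le_integral => //.
- apply: measurableT_comp => //.
  exact: (measurable_fubini_G intf).
- have mabs := measurableT_comp (@abse_measurable R setT) mf.
  exact: (measurable_fun_fubini_tonelli_G _ mabs (fun=> abse_ge0 _)).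
- move=> y _; apply: le_abse_integral => //.
  exact: (measurableT_comp mf (measurable_pair2 y)).
Qed.

(** The limit inherits the majorant of the family. *)
Lemma dominated_cvg_dominating S g I (F : R -> phase_fun R) F0 (a b : R) :
  (forall nu, g nu != 0 -> S nu) -> Defs.dominated_cvg S g I F F0 ->
  `[a, b] `<=` I ->
  exists h, [/\ dominating S g h, dominated_by S a b F0 h &
    \forall e \near 0^'+, dominated_by S a b (F e) h].
Proof.
move=> gS [FF0 domF] abI; have [H [iH iHg FH]] := domF a b abI.
pose h (w nu : R) := (1 + `|w|) * H w nu.
have w1 w : 0 <= 1 + `|w| :> R by rewrite addr_ge0.
have Fh : \forall e \near 0^'+, dominated_by S a b (F e) h.
  by apply: filterS FH => e FeH theta w nu t Snu tab; rewrite ler_wpM2l// FeH.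
exists h; split=> //.
- split=> //.
  have kE nu : \int[mu]_w ((1 + `|w|) * H w nu * g nu) = (\int[mu]_w h w nu) * g nu.
    have [->|gnu] := eqVneq (g nu) 0.
      by rewrite mulr0; under eq_Rintegral do rewrite mulr0; rewrite Rintegral_cst// mul0r.
    by rewrite RintegralZr//; exact/iH/gS.
  under eq_fun do rewrite -kE.
  apply: (@integrable_partial_integral
    (fun p => (1 + `|p.1|) * H p.1 p.2 * g p.2) S iHg).
  + move=> nu Snu.
    have := integrableZr measurableT (g nu) (iH nu Snu).
    by under eq_fun do rewrite -EFinM.
  + move=> nu nS w; have [->|/gS//] := eqVneq (g nu) 0.
    by rewrite mulr0.
- move=> theta w nu t Snu tab.
  have cF : (1 + `|w|) * `|F e theta w nu t| @[e --> 0^'+] -->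
      (1 + `|w|) * `|F0 theta w nu t|.
    apply: cvgM; first exact: cvg_cst.
    apply: cvg_norm; apply: FF0 => //; apply: abI.
    by rewrite /= in_itv.
  apply: (cvgr_to_le cF); apply: filterS Fh => e; exact.
Qed.

Lemma dominated_byW S a b F h theta w nu t : dominated_by S a b F h ->
  S nu -> a <= t <= b ->
  `|F theta w nu t| <= h w nu /\ `|w * F theta w nu t| <= h w nu.
Proof.
move=> /(_ theta w nu t) + Snu tab => /(_ Snu tab); rewrite mulrDl mul1r.
move=> H; split; apply: (le_trans _ H).
  by rewrite lerDl mulr_ge0.
by rewrite normrM lerDr.
Qed.

Lemma dominated_by_integrable S g a b F h theta nu t :
  dominating S g h -> dominated_by S a b F h -> S nu -> a <= t <= b ->
  measurable_fun setT (fun w => F theta w nu t) ->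
  [/\ mu.-integrable setT (fun w => (F theta w nu t)%:E),
    mu.-integrable setT (fun w => (w * F theta w nu t)%:E),
    `|\int[mu]_w F theta w nu t| <= \int[mu]_w h w nu &
    `|\int[mu]_w (w * F theta w nu t)| <= \int[mu]_w h w nu].
Proof.
move=> [ih _] Fh Snu tab mF.
have key (G : R -> R) : measurable_fun setT G -> (forall w, `|G w| <= h w nu) ->
    mu.-integrable setT (EFin \o G) /\ `|\int[mu]_w G w| <= \int[mu]_w h w nu.
  move=> mG Gh; have iG : mu.-integrable setT (EFin \o G).
    apply: le_integrable (ih nu Snu) => //; first exact/measurable_EFinP.
    by move=> w _ /=; rewrite lee_fin (le_trans (Gh w))// ler_norm.
  split=> //; rewrite (le_trans (le_normr_Rintegral _ _))//.
  apply: le_Rintegral => //; first exact: integrable_norm.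
  exact: ih.
have [i1 b1] := key _ mF (fun w => (dominated_byW theta w Fh Snu tab).1).
have [] := key (fun w => w * F theta w nu t).
- exact: measurable_funM.
- by move=> w; have [] := dominated_byW theta w Fh Snu tab.
by [].
Qed.

Lemma cvg_triple (T : Type) (G : set_system T) (FG : Filter G)
    (a b c : T -> R) (x y z : R) :
  a u @[u --> G] --> x -> b u @[u --> G] --> y -> c u @[u --> G] --> z ->
  (a u, b u, c u) @[u --> G] --> (x, y, z).
Proof.
move=> ax by_ cz; apply: (@cvg_pair _ _ _ _ (nbhs (x, y)) (nbhs z)) => //.
exact: (@cvg_pair _ _ _ _ (nbhs x) (nbhs y)).
Qed.

Lemma jointly_continuous_cvg S I F (T : Type) (G : set_system T)
    (FG : Filter G) (c : T -> R * R * R) nu theta w t :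
  jointly_continuous S I F -> S nu -> I t ->
  c y @[y --> G] --> (theta, w, t) -> (\forall y \near G, I (c y).2) ->
  F (c y).1.1 (c y).1.2 nu (c y).2 @[y --> G] --> F theta w nu t.
Proof.
move=> /(_ nu) + Snu It cG Ic => /(_ Snu)/subspace_continuousP.
move=> /(_ (theta, w, t) It) /= H.
apply: (cvg_trans _ H) => A /= /cG; rewrite !nbhs_simpl /=.
by apply: filterS2 Ic => y Iy; exact.
Qed.

Lemma jointly_continuous_velocity S I F theta nu t :
  jointly_continuous S I F -> S nu -> I t ->
  continuous (fun w => F theta w nu t).
Proof.
move=> cF Snu It w.
apply: (jointly_continuous_cvg (c := fun w => (theta, w, t)) _ cF) => //.
  by apply: cvg_triple; [exact: cvg_cst|exact: cvg_id|exact: cvg_cst].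
exact: nearW.
Qed.

End majorants.

(** * The limit of the kinetic equation *)

Section kinetic_limit.
Context {R : realType}.
Local Notation mu := (@lebesgue_measure R).

Lemma derivable_is_derive1 (F : R -> R) (x : R) :
  derivable F x 1 -> is_derive x 1 F (derive1 F x).
Proof. by move=> dF; apply: DeriveDef => //; rewrite derive1E. Qed.

Lemma derive1_val (F : R -> R) (x dF : R) :
  is_derive x 1 F dF -> derive1 F x = dF.
Proof. by rewrite derive1E => /@derive_val. Qed.

Lemma sub_itv_point (I : set R) t : I t -> `[t, t] `<=` I.
Proof. by move=> It x; rewrite /= in_itv/= => /le_anti <-. Qed.

Variables (alpha K : R) (g : R -> R) (S : set R).
Variables (f : R -> phase_fun R) (f0 : phase_fun R).
Hypothesis alpha_gt0 : 0 < alpha.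
Hypothesis g_ge0 : forall nu, 0 <= g nu.
Hypothesis g_supp : forall nu, g nu != 0 -> S nu.
Hypothesis f_sol :
  forall eps : R, 0 < eps -> kinetic_solution alpha K eps S g (f eps).
Hypothesis f_lim : regular_limit S g f f0.

Lemma near_solution :
  \forall e \near 0^'+, 0 < e /\ kinetic_solution alpha K e S g (f e).
Proof.
near=> e; have e0 : 0 < e by near: e; exact: nbhs_right_gt.
by split=> //; exact: f_sol.
Unshelve. all: by end_near. Qed.

Lemma cvg_limit theta w nu t : S nu -> 0 <= t ->
  f e theta w nu t @[e --> 0^'+] --> f0 theta w nu t.
Proof. by case: f_lim => _ [+ _] _ _ _; exact. Qed.

Lemma limit_ge0 theta w nu t : S nu -> 0 <= t -> 0 <= f0 theta w nu t.
Proof.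
move=> Snu t0; apply: (cvgr_to_ge (@cvg_limit theta w nu t Snu t0)).
by apply: filterS near_solution => e [_ [_ [fe0 _ _ _ _] _]]; exact: fe0.
Qed.

Lemma limit_periodic theta w nu t : S nu -> 0 <= t ->
  f0 (theta + 2 * pi) w nu t = f0 theta w nu t.
Proof.
move=> Snu t0; have H := @cvg_limit (theta + 2 * pi) w nu t Snu t0.
apply: (@cvg_unique _ (@Rhausdorff R) _ _ _ _ H).
apply: cvg_trans (@cvg_limit theta w nu t Snu t0); apply: near_eq_cvg.
by apply: filterS near_solution => e [_ [_ [_ fep _ _ _] _]]; rewrite fep.
Qed.

Lemma regular_measurable F theta nu t : regular S g F -> S nu -> 0 <= t ->
  measurable_fun setT (fun w => F theta w nu t).
Proof.
case=> _ cF _ _ Snu t0; apply: continuous_measurable_fun.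
exact: jointly_continuous_velocity cF Snu t0.
Qed.

Lemma limit_regular : regular S g f0.
Proof. by case: f_lim. Qed.

Lemma cvg_marginal theta nu t : S nu -> 0 <= t ->
  marginal (f e) theta nu t @[e --> 0^'+] --> marginal f0 theta nu t.
Proof.
move=> Snu t0; case: f_lim => _ domf _ _ _.
have [h [[ih _] _ fh]] :=
  dominated_cvg_dominating g_supp domf (sub_itv_point (I := [set t | 0 <= t]) t0).
have [] // := @dominated_cvg_at_right _ _ R mu 0
  (fun e w => f e theta w nu t) (fun w => f0 theta w nu t) (h ^~ nu).
- exact: ih.
- apply: filterS2 near_solution fh => e [_ [rf _ _]] fh; split.
    exact: regular_measurable.
  by move=> w; apply: (dominated_byW theta w fh Snu _).1; rewrite lexx.
- by move=> w; exact: cvg_limit.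
Qed.

(** The integrand in [nu] converges by [cvg_marginal], and the mass of the majorant
    in [w] dominates it. *)
Lemma cvg_Phi_integrable theta t : 0 <= t ->
  mu.-integrable setT (fun nu => (marginal f0 theta nu t * g nu)%:E) /\
  Phi g (f e) theta t @[e --> 0^'+] --> Phi g f0 theta t.
Proof.
move=> t0; case: f_lim => _ domf _ _ _.
have [h [ih _ fh]] :=
  dominated_cvg_dominating g_supp domf (sub_itv_point (I := [set t | 0 <= t]) t0).
apply: (@dominated_cvg_at_right _ _ R mu 0
  (fun e nu => marginal (f e) theta nu t * g nu)
  (fun nu => marginal f0 theta nu t * g nu)
  (fun nu => (\int[mu]_w h w nu) * g nu)); first exact: ih.2.
- apply: filterS2 near_solution fh => e [_ [rf [_ _ _ _ imf] _]] fh; split.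
    by have /integrableP[/measurable_EFinP] := imf theta t t0.
  move=> nu; rewrite normrM (ger0_norm (g_ge0 nu)).
  have [->|/g_supp Snu] := eqVneq (g nu) 0; first by rewrite !mulr0.
  apply: ler_wpM2r => //.
  have tt : t <= t <= t by rewrite lexx.
  by have [] := dominated_by_integrable ih fh Snu tt (regular_measurable theta rf Snu t0).
- move=> nu; have [->|/g_supp Snu] := eqVneq (g nu) 0.
    by rewrite mulr0; under eq_fun do rewrite mulr0; exact: cvg_cst.
  by apply: cvgMr_tmp; exact: cvg_marginal.
Qed.

Lemma collisionE F theta w nu t : regular S g F -> S nu -> 0 < t ->
  Q K g F theta w nu t = F theta w nu t
    + (w - (nu + K * Phi g F theta t)) * Dw F theta w nu t
    + Dw (Dw F) theta w nu t.
Proof.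
move=> [dF _ _ _] Snu t0; rewrite /Q; congr (_ + _).
have [_ /derivable_is_derive1 dwF _ _] := dF theta w nu t Snu t0.
rewrite derive1E; apply: derive_val.
apply: is_derive_eq; rewrite /GRing.scale/= /Dw; ring.
Qed.

Let V theta nu t := nu + K * Phi g f0 theta t.

(** The left-hand side of the equation is [eps] times a convergent quantity. *)
Lemma limit_collisionless theta w nu t : S nu -> 0 < t ->
  f0 theta w nu t + (w - V theta nu t) * Dw f0 theta w nu t
    + Dw (Dw f0) theta w nu t = 0.
Proof.
move=> Snu t0; have t0' := ltW t0.
case: f_lim => rf0 [cf _] [cth _] [ct _] [[cw _] [cww _]].
pose Qe e := f e theta w nu t
    + (w - (nu + K * Phi g (f e) theta t)) * Dw (f e) theta w nu t
    + Dw (Dw (f e)) theta w nu t.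
have cQ : Qe e @[e --> 0^'+] --> f0 theta w nu t
    + (w - V theta nu t) * Dw f0 theta w nu t + Dw (Dw f0) theta w nu t.
  apply: cvgD; last exact: cww.
  apply: cvgD; first exact: cf.
  apply: cvgM; last exact: cw.
  apply: cvgB; first exact: cvg_cst.
  apply: cvgD; first exact: cvg_cst.
  by apply: cvgMl_tmp; exact: (cvg_Phi_integrable theta t0').2.
apply: (@cvg_unique _ (@Rhausdorff R) _ _ _ _ cQ).
pose L e := e * (alpha * (Dt (f e) theta w nu t + w * Dtheta (f e) theta w nu t)).
have cL : L e @[e --> 0^'+] -->
    0 * (alpha * (Dt f0 theta w nu t + w * Dtheta f0 theta w nu t)).
  apply: cvgM; first exact: cvg_within.
  apply: cvgMl_tmp; apply: cvgD; first exact: ct.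
  by apply: cvgMl_tmp; exact: cth.
rewrite mul0r in cL.
apply: cvg_trans cL; apply: near_eq_cvg.
apply: filterS near_solution => e [_ [rf _ eqf]].
by rewrite /Qe /L -collisionE// -eqf// mulrA.
Qed.

Lemma velocity_integrable theta nu t : S nu -> 0 <= t ->
  mu.-integrable setT (fun w => (f0 theta w nu t)%:E) /\
  mu.-integrable setT (fun w => (w * f0 theta w nu t)%:E).
Proof.
move=> Snu t0; case: f_lim => rf0 domf _ _ _.
have [h [ih f0h _]] :=
  dominated_cvg_dominating g_supp domf (sub_itv_point (I := [set t | 0 <= t]) t0).
have tt : t <= t <= t by rewrite lexx.
by have [] := dominated_by_integrable ih f0h Snu tt (regular_measurable theta rf0 Snu t0).
Qed.

Lemma Dw_integrable theta nu t : S nu -> 0 < t ->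
  mu.-integrable setT (fun w => (Dw f0 theta w nu t)%:E).
Proof.
move=> Snu t0; case: f_lim => [[_ _ [_ cDw _ _] _]] _ _ _ [domw _].
have [h [ih f0h _]] :=
  dominated_cvg_dominating g_supp domw (sub_itv_point (I := [set t | 0 < t]) t0).
have tt : t <= t <= t by rewrite lexx.
have mD : measurable_fun setT (fun w => Dw f0 theta w nu t).
  apply: continuous_measurable_fun.
  exact: jointly_continuous_velocity cDw Snu t0.
by have [] := dominated_by_integrable ih f0h Snu tt mD.
Qed.

Lemma limit_profile theta nu t : S nu -> 0 < t ->
  (forall w, f0 theta w nu t =
    marginal f0 theta nu t * maxwellian (V theta nu t) w) /\
  \int[mu]_w (w * f0 theta w nu t) = V theta nu t * marginal f0 theta nu t.
Proof.
move=> Snu t0; have [if0 iwf0] := velocity_integrable theta Snu (ltW t0).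
have iDw := Dw_integrable theta Snu t0.
have [df0 _ _ _] := limit_regular.
have dphi (w : R) : is_derive w 1 (fun w => f0 theta w nu t) (Dw f0 theta w nu t).
  by have [_ /derivable_is_derive1] := df0 theta w nu t Snu t0.
have dphi1 (w : R) : is_derive w 1 (fun w => Dw f0 theta w nu t) (Dw (Dw f0) theta w nu t).
  by have [_ _ /derivable_is_derive1] := df0 theta w nu t Snu t0.
have cl w := limit_collisionless theta w Snu t0.
split.
  by move=> w; exact: (maxwellian_profile dphi dphi1 if0 iwf0 iDw cl w).
exact: (Rintegral_velocity dphi dphi1 if0 iwf0 iDw cl).
Qed.

(** The equation holds for positive times only; at time 0 both sides are the
    limits of their values at small positive times. *)
Lemma limit_equilibrium : equilibrium K S g f0 (marginal f0).
Proof.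
move=> theta w nu t Snu; rewrite le_eqVlt => /predU1P[<-|t0]; last first.
  by have [+ _] := limit_profile theta Snu t0; exact.
case: f_lim => rf0 domf _ _ _; case: (rf0) => _ cf0 _ mf0.
pose P := marginal f0.
have I0 : [set t | 0 <= t] 0 by rewrite /=.
have sub01 : `[0 : R, 1] `<=` [set t | 0 <= t].
  by move=> s; rewrite /= in_itv/= => /andP[].
have [h [ih f0h _]] := dominated_cvg_dominating g_supp domf sub01.
have near01 : \forall s \near (0 : R)^'+, 0 < s /\ 0 <= s <= 1.
  near=> s; have s0 : 0 < s by near: s; exact: nbhs_right_gt.
  split=> //; rewrite ltW//=; near: s; apply: nbhs_right_le; exact: ltr01.
have cf v nu' : S nu' -> f0 theta v nu' s @[s --> 0^'+] --> f0 theta v nu' 0.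
  move=> Snu'.
  apply: (jointly_continuous_cvg (c := fun s => (theta, v, s)) _ cf0) => //.
    apply: cvg_triple; [exact: cvg_cst|exact: cvg_cst|].
    exact: cvg_within.
  by apply: filterS near01 => s [_ /andP[]].
have cP nu' : S nu' -> P theta nu' s @[s --> 0^'+] --> P theta nu' 0.
  move=> Snu'.
  have [] // := @dominated_cvg_at_right _ _ R mu 0
    (fun s v => f0 theta v nu' s) (fun v => f0 theta v nu' 0) (h ^~ nu').
  - exact: ih.1.
  - apply: filterS near01 => s [s0 s01]; split.
      by apply: regular_measurable => //; exact: ltW.
    by move=> v; apply: (dominated_byW theta v f0h Snu' _).1.
  - by move=> v; exact: cf.
have cA : average g P theta s @[s --> 0^'+] --> average g P theta 0.
  have [] // := @dominated_cvg_at_right _ _ R mu 0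
    (fun s nu' => P theta nu' s * g nu') (fun nu' => P theta nu' 0 * g nu')
    (fun nu' => (\int[mu]_v h v nu') * g nu'); first exact: ih.2.
  - apply: filterS near01 => s [s0 s01]; split.
      by have [/integrableP[/measurable_EFinP]] := cvg_Phi_integrable theta (ltW s0).
    move=> nu'; rewrite normrM (ger0_norm (g_ge0 nu')).
    have [->|/g_supp Snu'] := eqVneq (g nu') 0; first by rewrite !mulr0.
    apply: ler_wpM2r => //.
    by have [] := dominated_by_integrable ih f0h Snu' s01
      (regular_measurable theta rf0 Snu' (ltW s0)).
  - move=> nu'; have [->|/g_supp Snu'] := eqVneq (g nu') 0.
      by rewrite mulr0; under eq_fun do rewrite mulr0; exact: cvg_cst.
    by apply: cvgMr_tmp; exact: cP.
have cM : P theta nu s * maxwellian (velocity K g P theta nu s) w @[s --> 0^'+]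
    --> P theta nu 0 * maxwellian (velocity K g P theta nu 0) w.
  apply: cvgM; first exact: cP.
  apply: cvgMl_tmp; apply: continuous_cvg; first exact: continuous_expR.
  apply: cvgN; apply: cvgMl_tmp.
  have cV : w - velocity K g P theta nu s @[s --> 0^'+]
      --> w - velocity K g P theta nu 0.
    apply: cvgB; first exact: cvg_cst.
    by apply: cvgD; [exact: cvg_cst|apply: cvgMl_tmp].
  by apply: cvgM; exact: cV.
apply: (@cvg_unique _ (@Rhausdorff R) _ _ _ _ (cf w nu Snu)).
apply: cvg_trans cM; apply: near_eq_cvg.
apply: filterS near01 => s [s0 _].
by rewrite (limit_profile theta Snu s0).1.
Unshelve. all: by end_near. Qed.

(** Before the limit the mean is [(eps * alpha)^-1] times the mean of the collision
    term, which is zero. *)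
Lemma transport_mean theta nu t : S nu -> 0 < t ->
  \int[mu]_w (Dt f0 theta w nu t + w * Dtheta f0 theta w nu t) = 0.
Proof.
move=> Snu t0; have t0' := ltW t0.
have tt : t <= t <= t by rewrite lexx.
case: f_lim => _ domf domth domt [domw _].
have sub0 := sub_itv_point (I := [set t | 0 <= t]) t0'.
have sub1 := sub_itv_point (I := [set t | 0 < t]) t0.
have [h [ih _ fh]] := dominated_cvg_dominating g_supp domf sub0.
have [hth [ihth _ fhth]] := dominated_cvg_dominating g_supp domth sub1.
have [ht [iht _ fht]] := dominated_cvg_dominating g_supp domt sub1.
have [hw [ihw _ fhw]] := dominated_cvg_dominating g_supp domw sub1.
pose T e w := Dt (f e) theta w nu t + w * Dtheta (f e) theta w nu t.
have cT e : regular S g (f e) -> continuous (T e).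
  move=> [_ _ [cth _ _ ct] _] w.
  apply: cvgD; first exact: (jointly_continuous_velocity ct Snu t0).
  by apply: cvgM; [exact: cvg_id|exact: (jointly_continuous_velocity cth Snu t0)].
have hT e w : dominated_by S t t (Dt (f e)) ht ->
    dominated_by S t t (Dtheta (f e)) hth -> `|T e w| <= ht w nu + hth w nu.
  move=> bt bth; rewrite (le_trans (ler_normD _ _))// lerD//.
    exact: (dominated_byW theta w bt Snu tt).1.
  exact: (dominated_byW theta w bth Snu tt).2.
have iH : mu.-integrable setT (fun w => (ht w nu + hth w nu)%:E).
  exact: (integrableD measurableT (iht.1 nu Snu) (ihth.1 nu Snu)).
have [] := @dominated_cvg_at_right _ _ R mu 0 T
  (fun w => Dt f0 theta w nu t + w * Dtheta f0 theta w nu t)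
  (fun w => ht w nu + hth w nu) iH.
- apply: filterS3 near_solution fht fhth => e [e0 [rf _ _]] bt bth; split.
    exact: continuous_measurable_fun (cT e rf).
  by move=> w; exact: hT.
- move=> w; apply: cvgD; first exact: domt.1.
  by apply: cvgMl_tmp; exact: domth.1.
move=> _ cint; apply: (@cvg_unique _ (@Rhausdorff R) _ _ _ _ cint).
apply: cvg_near_cst.
near=> e.
have [e0 [rf _ eqf]] : 0 < e /\ kinetic_solution alpha K e S g (f e).
  by near: e; exact: near_solution.
have bf : dominated_by S t t (f e) h by near: e.
have bth : dominated_by S t t (Dtheta (f e)) hth by near: e.
have bt : dominated_by S t t (Dt (f e)) ht by near: e.
have bw : dominated_by S t t (Dw (f e)) hw by near: e.
have [df _ [_ cw _ _] _] := rf.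
have mf := regular_measurable theta rf Snu t0'.
have mw : measurable_fun setT (fun w => Dw (f e) theta w nu t).
  apply: continuous_measurable_fun.
  exact: jointly_continuous_velocity cw Snu t0.
have [if_ iwf _ _] := dominated_by_integrable ih bf Snu tt mf.
have [iw _ _ _] := dominated_by_integrable ihw bw Snu tt mw.
have iT : mu.-integrable setT (EFin \o T e).
  apply: le_integrable iH => //.
    by apply/measurable_EFinP; exact: continuous_measurable_fun (cT e rf).
  by move=> w _ /=; rewrite lee_fin (le_trans (hT e w bt bth))// ler_norm.
have ea0 : e * alpha != 0 by rewrite gt_eqF// mulr_gt0.
apply: (mulfI ea0); rewrite mulr0 -RintegralZl//.
have dphi (w : R) :
    is_derive w 1 (fun w => f e theta w nu t) (Dw (f e) theta w nu t).
  by have [_ /derivable_is_derive1] := df theta w nu t Snu t0.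
have dphi1 (w : R) :
    is_derive w 1 (fun w => Dw (f e) theta w nu t) (Dw (Dw (f e)) theta w nu t).
  by have [_ _ /derivable_is_derive1] := df theta w nu t Snu t0.
have cpsi : continuous (fun w => e * alpha * T e w).
  by move=> w; apply: cvgMl_tmp; exact: (cT e rf).
have ipsi := integrableZl measurableT (e * alpha) iT.
apply: (Rintegral_collision_eq0 (V := nu + K * Phi g (f e) theta t)
  dphi dphi1 if_ iwf iw _ cpsi ipsi).
by move=> w; rewrite -collisionE// -eqf.
Unshelve. all: by end_near. Qed.

(** * The macroscopic equations *)
Let P := marginal f0.
Let Pth := marginal (Dtheta f0).
Let Pt := marginal (Dt f0).
Let Jth theta nu t := \int[mu]_w (w * Dtheta f0 theta w nu t).

Lemma positive_dominating Fe F (a b : R) :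
  Defs.dominated_cvg S g [set t | 0 < t] Fe F -> 0 < a ->
  exists h, dominating S g h /\ dominated_by S a b F h.
Proof.
move=> domF a0; have abI : `[a, b] `<=` [set t | 0 < t].
  by move=> s; rewrite /= in_itv/= => /andP[+ _]; exact: lt_le_trans.
by have [h [ih Fh _]] := dominated_cvg_dominating g_supp domF abI; exists h.
Qed.

Lemma positive_integrable Fe F theta nu t :
  Defs.dominated_cvg S g [set t | 0 < t] Fe F ->
  jointly_continuous S [set t | 0 < t] F -> S nu -> 0 < t ->
  mu.-integrable setT (fun w => (F theta w nu t)%:E) /\
  mu.-integrable setT (fun w => (w * F theta w nu t)%:E).
Proof.
move=> domF cF Snu t0; have [h [ih Fh]] := positive_dominating t domF t0.
have tt : t <= t <= t by rewrite lexx.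
have mF : measurable_fun setT (fun w => F theta w nu t).
  apply: continuous_measurable_fun.
  exact: jointly_continuous_velocity cF Snu t0.
by have [] := dominated_by_integrable ih Fh Snu tt mF.
Qed.

Lemma is_derive_limit_line (a l b s w nu : R) : S nu -> 0 < b + s ->
  is_derive s 1 (fun s => f0 (a + l * s) w nu (b + s))
    (l * Dtheta f0 (a + l * s) w nu (b + s) + Dt f0 (a + l * s) w nu (b + s)).
Proof.
move=> Snu; have [df0 _ [cth _ _ _] _] := limit_regular.
apply: (@is_derive_line R (fun x t => f0 x w nu t)
  (fun x t => Dtheta f0 x w nu t) (fun x t => Dt f0 x w nu t)).
- by move=> x t t0; have [/derivable_is_derive1] := df0 x w nu t Snu t0.
- by move=> x t t0; have [_ _ _ /derivable_is_derive1] := df0 x w nu t Snu t0.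
- move=> x t t0.
  apply: (jointly_continuous_cvg (c := fun p : R * R => (p.1, w, p.2)) _ cth) => //.
    by apply: cvg_triple; [exact: cvg_fst|exact: cvg_cst|exact: cvg_snd].
  exists ([set: R], [set r : R | 0 < r]) => /=; last by move=> [? ?] [].
  by split; [exact: filterT|exact: lt_nbhsr].
Qed.

(** A neighbourhood of a parameter on which the time [b + s] stays in a compact
    subset of the positive half-line. *)
Let window (b s : R) : 0 < b + s -> s - (b + s) / 2 < s < s + 1 /\
  forall r, s - (b + s) / 2 < r < s + 1 -> (b + s) / 2 <= b + r <= b + s + 1.
Proof.
move=> bs; split; first by rewrite gtrBl divr_gt0//= ltrDl ltr01.
by move=> r /andP[r1 r2]; apply/andP; split; lra.
Qed.

(** Derivatives are taken along all lines [(a + l * s, b + s)], because both the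
    Burgers equation and the free transport are solved along such lines. *)
Lemma is_derive_marginal_line (a l b s nu : R) : S nu -> 0 < b + s ->
  is_derive s 1 (fun s => P (a + l * s) nu (b + s))
    (l * Pth (a + l * s) nu (b + s) + Pt (a + l * s) nu (b + s)).
Proof.
move=> Snu bs; have [suv Hr] := window bs.
have bs2 : 0 < (b + s) / 2 by rewrite divr_gt0.
have [_ _ [cth _ _ ct] _] := limit_regular.
case: f_lim => _ _ domth domt _.
have [hth [ihth bth]] := positive_dominating (b + s + 1) domth bs2.
have [ht [iht bt]] := positive_dominating (b + s + 1) domt bs2.
have pos r : s - (b + s) / 2 < r < s + 1 -> 0 < b + r.
  by move=> /Hr/andP[+ _]; exact: lt_le_trans.
have bd r w : s - (b + s) / 2 < r < s + 1 ->
    `|l * Dtheta f0 (a + l * r) w nu (b + r) + Dt f0 (a + l * r) w nu (b + r)|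
      <= `|l| * hth w nu + ht w nu.
  move=> ruv; rewrite (le_trans (ler_normD _ _))// lerD//.
    rewrite normrM ler_wpM2l//.
    exact: (dominated_byW _ w bth Snu (Hr r ruv)).1.
  exact: (dominated_byW _ w bt Snu (Hr r ruv)).1.
have iG : mu.-integrable setT (fun w => (`|l| * hth w nu + ht w nu)%:E).
  have i := integrableZl measurableT `|l| (ihth.1 nu Snu).
  exact: (integrableD measurableT i (iht.1 nu Snu)).
have [_ +] := is_derive_under_integral suv
  (fun r ruv => (velocity_integrable (a + l * r) Snu (ltW (pos r ruv))).1)
  (fun r w ruv => is_derive_limit_line a l w Snu (pos r ruv)) bd iG.
have [ith _] := positive_integrable (a + l * s) domth cth Snu bs.
have [it _] := positive_integrable (a + l * s) domt ct Snu bs.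
rewrite RintegralD//; last exact: (integrableZl measurableT l ith).
by rewrite RintegralZl.
Qed.

(** Applied with [c = 1] for the mass and with [c w = w] for the momentum. *)
Lemma is_derive_moment_theta (c : R -> R) (theta nu t : R) :
  measurable_fun setT c -> (forall w, `|c w| <= 1 + `|w|) -> S nu -> 0 < t ->
  is_derive theta 1 (fun x => \int[mu]_w (c w * f0 x w nu t))
    (\int[mu]_w (c w * Dtheta f0 theta w nu t)).
Proof.
move=> mc c1 Snu t0; have t0' := ltW t0.
have [df0 _ _ _] := limit_regular.
case: f_lim => _ domf domth _ _.
have [hth [ihth bth]] := positive_dominating t domth t0.
have [h [ih bf _]] :=
  dominated_cvg_dominating g_supp domf (sub_itv_point (I := [set t | 0 <= t]) t0').
have tt : t <= t <= t by rewrite lexx.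
have uv : theta - 1 < theta < theta + 1 by rewrite gtrBl ltrDl ltr01.
have bd k (F : phase_fun R) x w : dominated_by S t t F k ->
    `|c w * F x w nu t| <= k w nu.
  move=> bF; apply: le_trans (bF x w nu t Snu tt).
  by rewrite normrM ler_wpM2r.
have iF x : theta - 1 < x < theta + 1 ->
    mu.-integrable setT (fun w => (c w * f0 x w nu t)%:E).
  move=> _; apply: le_integrable (ih.1 nu Snu) => //.
    apply/measurable_EFinP/measurable_funM => //.
    exact: regular_measurable limit_regular Snu t0'.
  move=> w _ /=; rewrite lee_fin (le_trans (bd h f0 x w bf))//.
  exact: ler_norm.
have dF (x w : R) : theta - 1 < x < theta + 1 ->
    is_derive x 1 (fun x => c w * f0 x w nu t) (c w * Dtheta f0 x w nu t).
  move=> _; have [/derivable_is_derive1 dx _ _ _] := df0 x w nu t Snu t0.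
  by apply: is_derive_eq; rewrite /GRing.scale/= /Dtheta ?mulr0 ?addr0.
by have [_] := is_derive_under_integral uv iF dF
  (fun x w _ => bd hth _ x w bth) (ihth.1 nu Snu).
Qed.

Lemma is_derive_marginal_theta (theta nu t : R) : S nu -> 0 < t ->
  is_derive theta 1 (fun x => P x nu t) (Pth theta nu t).
Proof.
move=> Snu t0; have := @is_derive_moment_theta (cst 1) theta nu t.
have E F x : \int[mu]_w (cst 1 w * F x w nu t) = marginal F x nu t.
  by apply: eq_Rintegral => w _; rewrite mul1r.
rewrite E; under eq_fun do rewrite E.
apply=> // w; first by rewrite normr1 lerDl.
Qed.

(** The momentum of the limit is [V * P], so it can be differentiated under the
    integral in [w]. *)
Lemma is_derive_momentum_theta (theta nu t : R) : S nu -> 0 < t ->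
  is_derive theta 1 (fun x => V x nu t * P x nu t) (Jth theta nu t).
Proof.
move=> Snu t0; have := @is_derive_moment_theta id theta nu t.
have -> : (fun x => \int[mu]_w (id w * f0 x w nu t)) =
    (fun x => V x nu t * P x nu t).
  by apply/funext => x; rewrite -(limit_profile x Snu t0).2.
apply=> // w; by rewrite lerDr.
Qed.

Lemma mass_balance theta nu t : S nu -> 0 < t ->
  Pt theta nu t + Jth theta nu t = 0.
Proof.
move=> Snu t0; rewrite -(transport_mean theta Snu t0).
have [_ _ [cth _ _ ct] _] := limit_regular.
case: f_lim => _ _ domth domt _.
have [it _] := positive_integrable theta domt ct Snu t0.
have [_ ith] := positive_integrable theta domth cth Snu t0.
by rewrite RintegralD.
Qed.

Lemma limit_continuity_equation : continuity_equation K S g P.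
Proof.
move=> theta nu t Snu t0 /=.
have dt : is_derive t 1 (fun s => P theta nu s) (Pt theta nu t).
  have := @is_derive_marginal_line theta 0 0 t nu Snu; rewrite add0r.
  under eq_fun do rewrite mul0r addr0 add0r.
  by rewrite !mul0r addr0 add0r; exact.
have dth := is_derive_momentum_theta theta Snu t0.
split; [exact: ex_derive|exact: (@ex_derive _ _ _ _ _ _ _ dth)|].
rewrite !derive1E (@derive_val _ _ _ _ _ _ _ dt) (@derive_val _ _ _ _ _ _ _ dth).
exact: mass_balance.
Qed.

Lemma marginal_dominating Fe F (a b : R) :
  Defs.dominated_cvg S g [set t | 0 < t] Fe F ->
  jointly_continuous S [set t | 0 < t] F -> 0 < a ->
  exists2 k : R -> R, mu.-integrable setT (EFin \o k) &
    forall theta nu t, a <= t <= b ->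
      `|marginal F theta nu t * g nu| <= k nu /\
      `|(\int[mu]_w (w * F theta w nu t)) * g nu| <= k nu.
Proof.
move=> domF cF a0; have [h [ih bF]] := positive_dominating b domF a0.
exists (fun nu => (\int[mu]_w h w nu) * g nu); first exact: ih.2.
move=> theta nu t tab; rewrite !normrM (ger0_norm (g_ge0 nu)).
have [->|/g_supp Snu] := eqVneq (g nu) 0; first by rewrite !mulr0.
have t0 : 0 < t by case/andP: tab => + _; exact: lt_le_trans.
have mF : measurable_fun setT (fun w => F theta w nu t).
  apply: continuous_measurable_fun.
  exact: jointly_continuous_velocity cF Snu t0.
have [_ _ b1 b2] := dominated_by_integrable ih bF Snu tab mF.
by split; exact: ler_wpM2r.
Qed.

Let U := average g Pth.
Let A := average g P.

Lemma average_integrable theta t : 0 <= t ->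
  mu.-integrable setT (fun nu => (P theta nu t * g nu)%:E).
Proof. by move=> t0; exact: (cvg_Phi_integrable theta t0).1. Qed.

Lemma is_derive_average_theta (theta t : R) : 0 < t ->
  mu.-integrable setT (fun nu => (Pth theta nu t * g nu)%:E) /\
  is_derive theta 1 (fun x => A x t) (U theta t).
Proof.
move=> t0; have [_ _ [cth _ _ _] _] := limit_regular.
case: f_lim => _ _ domth _ _.
have [k ik bk] := marginal_dominating t domth cth t0.
have tt : t <= t <= t by rewrite lexx.
have uv : theta - 1 < theta < theta + 1 by rewrite gtrBl ltrDl ltr01.
have dF (x nu : R) : theta - 1 < x < theta + 1 ->
    is_derive x 1 (fun x => P x nu t * g nu) (Pth x nu t * g nu).
  by move=> _; apply: is_derive_weight => /g_supp Snu; exact: is_derive_marginal_theta.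
exact: (is_derive_under_integral uv (fun x _ => average_integrable x (ltW t0)) dF
  (fun x nu _ => (bk x nu t tt).1) ik).
Qed.

Lemma is_derive_average_along (a l b s : R) : 0 < b + s ->
  mu.-integrable setT (fun nu =>
    ((l * Pth (a + l * s) nu (b + s) + Pt (a + l * s) nu (b + s)) * g nu)%:E) /\
  is_derive s 1 (fun s => A (a + l * s) (b + s))
    (\int[mu]_nu
      ((l * Pth (a + l * s) nu (b + s) + Pt (a + l * s) nu (b + s)) * g nu)).
Proof.
move=> bs; have [suv Hr] := window bs.
have bs2 : 0 < (b + s) / 2 by rewrite divr_gt0.
have [_ _ [cth _ _ ct] _] := limit_regular.
case: f_lim => _ _ domth domt _.
have [kth ith bth] := marginal_dominating (b + s + 1) domth cth bs2.
have [kt it bt] := marginal_dominating (b + s + 1) domt ct bs2.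
have pos r : s - (b + s) / 2 < r < s + 1 -> 0 < b + r.
  by move=> /Hr/andP[+ _]; exact: lt_le_trans.
have dF (r nu : R) : s - (b + s) / 2 < r < s + 1 ->
    is_derive r 1 (fun r => P (a + l * r) nu (b + r) * g nu)
      ((l * Pth (a + l * r) nu (b + r) + Pt (a + l * r) nu (b + r)) * g nu).
  move=> ruv; apply: is_derive_weight => /g_supp Snu.
  exact: is_derive_marginal_line (pos r ruv).
have bd r nu : s - (b + s) / 2 < r < s + 1 ->
    `|(l * Pth (a + l * r) nu (b + r) + Pt (a + l * r) nu (b + r)) * g nu|
      <= `|l| * kth nu + kt nu.
  move=> ruv; rewrite mulrDl -mulrA (le_trans (ler_normD _ _))// lerD//.
    by rewrite normrM ler_wpM2l//; exact: (bth _ _ _ (Hr r ruv)).1.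
  exact: (bt _ _ _ (Hr r ruv)).1.
have iG : mu.-integrable setT (fun nu => (`|l| * kth nu + kt nu)%:E).
  exact: (integrableD measurableT (integrableZl measurableT `|l| ith) it).
exact: (is_derive_under_integral suv
  (fun r ruv => average_integrable (a + l * r) (ltW (pos r ruv))) dF bd iG).
Qed.

Lemma average_Pt_integrable theta t : 0 < t ->
  mu.-integrable setT (fun nu => (Pt theta nu t * g nu)%:E).
Proof.
rewrite -[t]add0r => t0; have [+ _] := is_derive_average_along theta 0 t0.
by rewrite mul0r addr0; under eq_fun do rewrite mul0r add0r.
Qed.

Variable C : R.
Hypothesis P_moment : constant_first_moment g P C.

Lemma average_momentum theta t : 0 < t ->
  mu.-integrable setT (fun nu => (V theta nu t * P theta nu t * g nu)%:E) /\
  \int[mu]_nu (V theta nu t * P theta nu t * g nu) = C + K * A theta t ^+ 2.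
Proof.
move=> /ltW t0; have [inP mC] := P_moment theta t0.
have iP := average_integrable theta t0.
have iKP : mu.-integrable setT
    (fun nu => (K * A theta t * (P theta nu t * g nu))%:E).
  exact: (integrableZl measurableT (K * A theta t) iP).
have E nu : V theta nu t * P theta nu t * g nu =
    nu * P theta nu t * g nu + K * A theta t * (P theta nu t * g nu).
  by rewrite /V -[Phi _ _ _ _]/(A theta t); ring.
split.
  under eq_fun do rewrite E.
  exact: (integrableD measurableT inP iKP).
under eq_Rintegral do rewrite E.
rewrite RintegralD// RintegralZl// -[X in X + _]/(first_moment g P theta t) mC.
by rewrite -[X in _ * X]/(A theta t); ring.
Qed.

(** Averaged against [g], the momentum is the constant first moment plus
    [K * A ^+ 2]; its derivative in [theta] is the opposite of the time derivative
    of [A]. *)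
Lemma average_burgers theta t : 0 < t ->
  average g Pt theta t = - (2 * K * A theta t) * U theta t.
Proof.
move=> t0; have [_ _ [cth _ _ _] _] := limit_regular.
case: f_lim => _ _ domth _ _.
have [k ik bk] := marginal_dominating t domth cth t0.
have tt : t <= t <= t by rewrite lexx.
have uv : theta - 1 < theta < theta + 1 by rewrite gtrBl ltrDl ltr01.
have dF (x nu : R) : theta - 1 < x < theta + 1 ->
    is_derive x 1 (fun x => V x nu t * P x nu t * g nu) (Jth x nu t * g nu).
  by move=> _; apply: is_derive_weight => /g_supp Snu; exact: is_derive_momentum_theta.
have [iJ] := is_derive_under_integral uv
  (fun x _ => (average_momentum x t0).1) dF (fun x nu _ => (bk x nu t tt).2) ik.
have -> : (fun x => \int[mu]_nu (V x nu t * P x nu t * g nu)) =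
    (fun x => C + K * A x t ^+ 2).
  by apply/funext => x; rewrite (average_momentum x t0).2.
have [_ dA] := is_derive_average_theta theta t0.
have dA2 : is_derive theta 1 (fun x => C + K * A x t ^+ 2)
    (2 * K * A theta t * U theta t).
  by apply: is_derive_eq; rewrite /GRing.scale/=; ring.
move=> /is_derive_unique/(_ dA2) JE; rewrite mulNr -JE.
rewrite /average -[RHS]mulN1r -RintegralZl//.
apply: eq_Rintegral => nu _.
have [->|/g_supp Snu] := eqVneq (g nu) 0; first by rewrite !mulr0.
by have := mass_balance theta Snu t0 => /eqP; rewrite addr_eq0 => /eqP ->; ring.
Qed.

Lemma average_burgers_line (a l b s : R) : 0 < b + s ->
  is_derive s 1 (fun s => A (a + l * s) (b + s))
    ((l - 2 * K * A (a + l * s) (b + s)) * U (a + l * s) (b + s)).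
Proof.
move=> bs; have [_] := is_derive_average_along a l bs.
have [ith _] := is_derive_average_theta (a + l * s) bs.
have it := average_Pt_integrable (a + l * s) bs.
have UE : (l - 2 * K * A (a + l * s) (b + s)) * U (a + l * s) (b + s) =
    l * average g Pth (a + l * s) (b + s) + average g Pt (a + l * s) (b + s).
  apply: etrans (congr1 (fun z => l * U (a + l * s) (b + s) + z)
    (esym (average_burgers (a + l * s) bs))).
  by rewrite mulrBl mulNr.
have ilth : mu.-integrable setT
    (fun nu => (l * (Pth (a + l * s) nu (b + s) * g nu))%:E).
  exact: (integrableZl measurableT l ith).
under eq_Rintegral do rewrite mulrDl -mulrA.
rewrite (@RintegralD _ _ R mu setT
  (fun nu => l * (Pth (a + l * s) nu (b + s) * g nu))
  (fun nu => Pt (a + l * s) nu (b + s) * g nu) measurableT ilth it).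
rewrite (@RintegralZl _ _ R mu setT
  (fun nu => Pth (a + l * s) nu (b + s) * g nu) l measurableT ith).
by rewrite UE.
Qed.

Lemma average_periodic theta t : 0 < t -> A (theta + 2 * pi) t = A theta t.
Proof.
move=> t0; apply: eq_Rintegral => nu _.
have [->|/g_supp Snu] := eqVneq (g nu) 0; first by rewrite !mulr0.
by congr (_ * _); apply: eq_Rintegral => w _; rewrite limit_periodic// ltW.
Qed.

Lemma average_gradient_bounded (a b : R) : 0 < a ->
  exists L, forall theta t, a <= t <= b -> `|U theta t| <= L.
Proof.
move=> a0; have [_ _ [cth _ _ _] _] := limit_regular.
case: f_lim => _ _ domth _ _.
have [k ik bk] := marginal_dominating b domth cth a0.
exists (\int[mu]_nu k nu) => theta t tab.
have t0 : 0 < t by case/andP: tab => + _; exact: lt_le_trans.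
have [ith _] := is_derive_average_theta theta t0.
rewrite (le_trans (le_normr_Rintegral _ _))//.
apply: le_Rintegral => //; first exact: (integrable_norm ith).
by move=> nu _; exact: (bk theta nu t tab).1.
Qed.

(** The two cases rest on different mechanisms: for [K != 0] crossing of
    characteristics, for [K = 0] mixing by the spread of the speeds. *)
Lemma average_gradient_eq0 theta t : 0 < t -> U theta t = 0.
Proof.
move=> t0; have [K0|K0] := eqVneq K 0; last first.
  have [_ dA] := is_derive_average_theta theta t0.
  apply: (is_derive_unique dA).
  have -> : (fun x => A x t) = cst (A theta t).
    apply/funext => x; apply: (periodic_burgers_cst (k := 2 * K) (p := 2 * pi)
      _ _ average_burgers_line average_gradient_bounded average_periodic _ _ t0).
      by rewrite mulf_neq0.
    by rewrite mulr_gt0// pi_gt0.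
  exact: is_derive_cst.
have [_ _ [cth _ _ _] _] := limit_regular.
case: (f_lim) => _ _ domth _ _.
have [k ik bk] := marginal_dominating t domth cth t0.
have tt : t <= t <= t by rewrite lexx.
apply: (@free_transport_average_derive R g k P Pth t t0 g_ge0).
- move=> x nu s /g_supp Snu s0; apply: Rintegral_ge0 => w _.
  exact/limit_ge0/ltW.
- by move=> x s /ltW; exact: average_integrable.
- move=> a l b s nu /g_supp Snu bs.
  have dP := is_derive_marginal_line a l Snu bs.
  have JE : Jth (a + l * s) nu (b + s) = nu * Pth (a + l * s) nu (b + s).
    have dJ := is_derive_momentum_theta (a + l * s) Snu bs.
    have dth := is_derive_marginal_theta (a + l * s) Snu bs.
    have VE x : V x nu (b + s) = nu by rewrite /V K0 mul0r addr0.
    have dJ' : is_derive (a + l * s) 1 (fun x => V x nu (b + s) * P x nu (b + s))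
        (nu * Pth (a + l * s) nu (b + s)).
      under eq_fun do rewrite VE.
      by apply: is_derive_eq; rewrite /GRing.scale/=; ring.
    exact: is_derive_unique dJ dJ'.
  have := mass_balance (a + l * s) Snu bs; rewrite JE => /eqP.
  by rewrite addr_eq0 mulrBl => /eqP <-.
- by move=> x nu s /g_supp Snu s0; exact: is_derive_marginal_theta.
- by move=> x nu; exact: (bk x nu t tt).1.
- exact: ik.
- by move=> x s s0; exact: (is_derive_average_theta x s0).1.
- by move=> x s s0; exact: (is_derive_average_theta x s0).2.
- move=> x s r s0 r0.
  have stat s' r' : 0 < s' -> s' <= r' -> A x s' = A x r'.
    move=> s'0 sr; have sr0 : 0 <= r' - s' by rewrite subr_ge0.
    have := burgers_straight_line x average_burgers_line average_gradient_bounded s'0 sr0.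
    by rewrite K0 mulr0 !mul0r addr0 addrCA subrr addr0 => E; exact: esym E.
  by have [sr|/ltW rs] := leP s r; [exact: stat|symmetry; exact: stat].
Qed.

Lemma is_derive_average_time (theta t : R) : 0 < t ->
  is_derive t 1 (fun s => A theta s) 0.
Proof.
move=> t0; have := @average_burgers_line theta 0 0 t; rewrite add0r.
under eq_fun do rewrite mul0r addr0 add0r.
by rewrite !mul0r addr0 average_gradient_eq0// mulr0; exact.
Qed.

(** Since [A] is constant in [theta], the Burgers equation makes it constant in
    time, and the three terms vanish separately. *)
Lemma limit_velocity_equation : velocity_equation K g P.
Proof.
move=> theta nu t t0 /=.
have dAt := is_derive_average_time theta t0.
have dAth : is_derive theta 1 (fun x => A x t) 0.
  by rewrite -(average_gradient_eq0 theta t0); exact: (is_derive_average_theta theta t0).2.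
have dVt : is_derive t 1 (fun s => velocity K g P theta nu s) 0.
  by have := is_derive_affine nu K dAt; rewrite mulr0.
have dVth : is_derive theta 1 (fun x => velocity K g P x nu t) 0.
  by have := is_derive_affine nu K dAth; rewrite mulr0.
split; [exact: (@ex_derive _ _ _ _ _ _ _ dVt)|
  exact: (@ex_derive _ _ _ _ _ _ _ dVth)|
  exact: (@ex_derive _ _ _ _ _ _ _ dAth)|].
have e1 := derive1_val dVt; have e2 := derive1_val dVth.
have e3 := derive1_val dAth.
by rewrite [X in _ * X + _ + _]e1 [X in _ + _ * X + _]e2 [X in _ + _ + X]e3 !mulr0 !addr0.
Qed.

(** Where the average vanishes, the nonnegative density [P * g] is zero for almost
    every [nu], and so is the first moment. *)
Lemma average_Yfun theta t : 0 <= t ->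
  A theta t * Yfun g P theta t = first_moment g P theta t.
Proof.
move=> t0; rewrite /Yfun; have [A0|A0] := eqVneq (A theta t) 0; last first.
  by rewrite mulrC divfK.
rewrite A0 mul0r.
have iP := average_integrable theta t0.
have Pg0 nu : 0 <= P theta nu t * g nu.
  have [->|/g_supp Snu] := eqVneq (g nu) 0; first by rewrite mulr0.
  by rewrite mulr_ge0//; apply: Rintegral_ge0 => w _; exact: limit_ge0.
have : (\int[mu]_nu `|(P theta nu t * g nu)%:E| = 0)%E.
  under eq_integral do rewrite /= ger0_norm//.
  by rewrite -(fineK (integrable_fin_num measurableT iP)) -[fine _]/(A theta t) A0.
move/(ae_eq_integral_abs mu measurableT (measurable_int _ iP)) => Pae.
have [inP _] := P_moment theta t0.
have -> : first_moment g P theta t = \int[mu]_nu (cst 0 : R -> R) nu.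
  congr fine; apply: ae_eq_integral => //; first exact: (measurable_int _ inP).
    by apply/measurable_EFinP.
  apply: filterS Pae => nu /= /(_ I) [Pg] _.
  by rewrite -mulrA Pg mulr0.
by rewrite Rintegral_cst// mul0r.
Qed.

End kinetic_limit.

Theorem theorem3p3 (R : realType) (alpha K C : R) (g : R -> R) (S : set R)
    (f : R -> phase_fun R) (f0 : phase_fun R)
    (alpha_gt0 : 0 < alpha)
    (g_density : probability_density g)
    (g_supp : forall nu, g nu != 0 -> S nu)
    (f_sol : forall eps : R, 0 < eps -> kinetic_solution alpha K eps S g (f eps))
    (f_lim : regular_limit S g f f0)
    (f0_norm : forall P : R -> R -> R -> R,
       equilibrium K S g f0 P -> normalized S P)
    (f0_moment : forall P : R -> R -> R -> R,
       equilibrium K S g f0 P -> constant_first_moment g P C) :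
  exists P : R -> R -> R -> R,
    [/\ equilibrium K S g f0 P,
        [/\ L1_density S g P, normalized S P & constant_first_moment g P C],
        forall V : R,
          (\int[@lebesgue_measure R]_w (maxwellian V w)%:E = 1)%E,
        forall theta t : R, 0 <= t ->
          average g P theta t * Yfun g P theta t = first_moment g P theta t
      & continuity_equation K S g P /\ velocity_equation K g P].
Proof.
have [_ g_ge0 _] := g_density.
have eqP := limit_equilibrium g_ge0 g_supp f_sol f_lim.
have momP := f0_moment _ eqP.
exists (marginal f0); split=> //.
- split=> //; last exact: f0_norm.
  split=> theta.
    move=> nu t Snu t0; apply: Rintegral_ge0 => w _.
    exact: (limit_ge0 f_sol f_lim).
  move=> t t0; exact: (average_integrable g_ge0 g_supp f_sol f_lim).
- exact: integral_maxwellian.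
- by move=> theta t; exact: (average_Yfun g_ge0 g_supp f_sol f_lim momP).
split; first exact: (limit_continuity_equation alpha_gt0 g_ge0 g_supp f_sol f_lim).
exact: (limit_velocity_equation alpha_gt0 g_ge0 g_supp f_sol f_lim momP).
Qed.
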